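(* There exist a positive absolute constant $c$ and a sequence of weights $w\in A_2^d$ such that $[w]_{A_2^d}\to\infty$ along the sequence and at the same time, for the weights $w$ of the sequence: (1) $[w]_{A_2^d}\asymp \|M^d\|_{w^{-1}}^2$; (2) $\|S_w: L^2(w)\to L^2(w^{-1})\|\ \ge\ c\,\|M^d\|_{w^{-1}}\sqrt{\log\|M^d\|_{w^{-1}}}$; (3) $\|S_w: L^{2,1}(w)\to L^2(w^{-1})\|\ \ge\ c\,\|M^d\|_{w^{-1}}\sqrt{\log\|M^d\|_{w^{-1}}}$; (4) $\|S: L^2(w)\to L^2(w)\|\ \ge\ c\,\|M^d\|_{w}\sqrt{\log\|M^d\|_{w}}$.
   Context: Everything lives on $I_0=[0,1)$; $\mathcal D$ is the family of dyadic subintervals of $I_0$ (including $I_0$), and $\langle f\rangle_J=\frac1{|J|}\int_J f\,dx$. A weight is an a.e. positive function $w$ on $I_0$ with $w,w^{-1}$ integrable; $w$ is identified with the measure $w\,dx$. $[w]_{A_2^d}=\sup_{J\in\mathcal D}\langle w\rangle_J\langle w^{-1}\rangle_J$, and $w\in A_2^d$ means that this is finite. $M^d f(x)=\sup_{J\in\mathcal D,\, J\ni x}\langle|f|\rangle_J$ is the dyadic maximal operator, and for a weight $v$, $\|M^d\|_{v}$ denotes its norm $L^2(v)\to L^2(v)$. $h_I$ is the $L^2(dx)$-normalized Haar function of $I\in\mathcal D$, and $Sf(x)=\big(\sum_{I\in\mathcal D}(f,h_I)^2\frac{\chi_I(x)}{|I|}\big)^{1/2}$ is the dyadic square function, where $(f,h_I)=\int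 f h_I\,dx$. For a weight $w$, $S_w f:=S(wf)$. The Lorentz norm is $\|f\|_{L^{2,1}(\mu)}=\int_0^\infty(\mu\{x:|f(x)|>t\})^{1/2}dt$. Norms of the sublinear operators $S,S_w,M^d$ are the best constants in the corresponding inequalities. $X\asymp Y$ means $c_1Y\le X\le c_2Y$ with absolute constants $c_1,c_2>0$ (the same for the whole sequence). *)

(* Defs.v *)
From HB Require Import structures.
From mathcomp Require Import all_boot all_order all_algebra.
From mathcomp Require Import all_classical all_reals all_analysis.

Set Implicit Arguments.
Unset Strict Implicit.
Unset Printing Implicit Defensive.

Import Order.TTheory GRing.Theory Num.Theory.
Import numFieldNormedType.Exports.

Local Open Scope classical_set_scope.
Local Open Scope ring_scope.

(* Functions on [0, 1) are represented by functions on R, of which only the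
   values on I0 are used.  Norms and operator values are extended reals, so that
   no finiteness is built into the definitions. *)

Section dyadic_analysis.
Context {R : realType}.
Local Notation mu := (@lebesgue_measure R).

Definition I0 : set R := `[0, 1[.

Definition dyad (n k : nat) : set R :=
  `[k%:R / 2 ^+ n, k.+1%:R / 2 ^+ n[.

Definition dyadic : set (set R) :=
  [set J | exists n k : nat, (k < 2 ^ n)%N /\ J = dyad n k].

Definition len (J : set R) : R := fine (mu J).

Definition avg (J : set R) (f : R -> R) : \bar R :=
  ((len J)^-1%:E * \int[mu]_(x in J) (f x)%:E)%E.

Definition recip (w : R -> R) (x : R) : R := (w x)^-1.

Definition weight (w : R -> R) : Prop :=
  [/\ {ae mu, forall x, I0 x -> 0 < w x},
      mu.-integrable I0 (fun x => (w x)%:E) &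
      mu.-integrable I0 (fun x => (recip w x)%:E)].

Definition A2const (w : R -> R) : \bar R :=
  ereal_sup [set (avg J w * avg J (recip w))%E | J in dyadic].

Definition A2 (w : R -> R) : Prop := weight w /\ (A2const w < +oo)%E.

Definition maximal (f : R -> R) (x : R) : \bar R :=
  ereal_sup [set avg J (fun y => `|f y|) | J in [set J | dyadic J /\ J x]].

(* dyad n.+1 k.*2 and dyad n.+1 k.*2.+1 are the left and right halves of
   dyad n k. *)
Definition haar (n k : nat) (x : R) : R :=
  (Num.sqrt (len (dyad n k)))^-1 *
  (\1_(dyad n.+1 k.*2.+1) x - \1_(dyad n.+1 k.*2) x).

Definition haar_coef (f : R -> R) (n k : nat) : \bar R :=
  \int[mu]_(x in I0) (f x * haar n k x)%:E.

Definition square_fun (f : R -> R) (x : R) : \bar R :=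
  ((\sum_(0 <= n <oo) \sum_(k < 2 ^ n)
      haar_coef f n k ^+ 2 * (\1_(dyad n k) x / len (dyad n k))%:E) `^ 2^-1)%E.

Definition square_fun_weighted (w f : R -> R) : R -> \bar R :=
  square_fun (fun x => w x * f x).

Definition wmeas (w : R -> R) (A : set R) : \bar R :=
  \int[mu]_(x in I0 `&` A) (w x)%:E.

Definition L2norm (w : R -> R) (g : R -> \bar R) : \bar R :=
  ((\int[mu]_(x in I0) (g x ^+ 2 * (w x)%:E)) `^ 2^-1)%E.

Definition L21norm (w : R -> R) (g : R -> \bar R) : \bar R :=
  (\int[mu]_(t in `]0%R, +oo[) (wmeas w [set x | t%:E < `|g x|] `^ 2^-1))%E.

(* The best constant in  NY (T f) <= C * NX f,  over all measurable f with
   NX f finite; it is +oo when no finite constant works. *)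
Definition opnorm (NX NY : (R -> \bar R) -> \bar R)
    (T : (R -> R) -> (R -> \bar R)) : \bar R :=
  ereal_inf [set C%:E | C in [set C : R | 0 <= C /\
    forall f : R -> R, measurable_fun I0 f ->
      (NX (EFin \o f) < +oo)%E ->
      (NY (T f) <= C%:E * NX (EFin \o f))%E]].

Definition maximal_norm (v : R -> R) : \bar R :=
  opnorm (L2norm v) (L2norm v) maximal.

End dyadic_analysis.

(* Main.v *)
Require Import Defs.
From HB Require Import structures.
From mathcomp Require Import all_boot all_order all_algebra.
From mathcomp Require Import all_classical all_reals all_analysis.
From mathcomp Require Import measurable_realfun ring lra.
Import Order.TTheory GRing.Theory Num.Theory.
Import numFieldNormedType.Exports.

(** With s = 1/v, the norms of M and S on L^2(v) are governed by their action on
    s alone: by Sawyer's theorem M is bounded by a multiple of K as soon as the integrals of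
    M(s 1_J)^2 v over J are at most K^2 s(J), while S is tested from below on s
    itself.  So one wants w and 1/w with M(w 1_J) of size K in L^2(1/w), and with
    many dyadic scales on which the averages of w oscillate.

    Fix N = 4^L.  On an interval of level j the average u_j of w stays within a
    bounded factor of u_j during L double steps u -> (2 - 1/N) u -> u, each of
    which multiplies the average of 1/w by about 4, from N/u_j up to N^2/u_j.  The
    square function sees all L steps, the maximal function sees u_j only once, and
    [w]_{A_2} is about N^2.  One level contributes only a fraction 1/N of what is
    needed; but the quarters split off during the oscillation carry almost all
    the w-mass and are intervals of the next level, u_{j+1} = (3 - 2/N) u_j, so
    that N levels can be stacked.  This gives ||S||^2 >= c N^2 L against
    ||M||^2 <= C N^2 for both weights w and 1/w.  Placing w and 1/w side by side
    in [0, 1) yields all the estimates for a single weight. *)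

Set Implicit Arguments.
Unset Strict Implicit.
Unset Printing Implicit Defensive.

Local Open Scope classical_set_scope.
Local Open Scope ring_scope.

(** * Weights as dyadic trees and their testing integrals *)

Section dyadic_trees.
Variable R : realType.

(* [Node l r] carries [l] on the left and [r] on the right half of a dyadic
   interval; a leaf is a constant. *)
Inductive tree := Leaf of R | Node of tree & tree.

Fixpoint mean t := match t with Leaf c => c | Node l r => (mean l + mean r) / 2 end.

Fixpoint tinv t := match t with Leaf c => Leaf c^-1 | Node l r => Node (tinv l) (tinv r) end.

(** A leaf is its own child: a constant may be halved indefinitely, so a subtree exists over every
    dyadic interval. *)
Definition child (b : bool) t :=
  match t with Leaf c => Leaf c | Node l r => if b then r else l end.

Fixpoint allsub (P : tree -> Prop) t :=
  P t /\ match t with Leaf _ => True | Node l r => allsub P l /\ allsub P r end.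

Fixpoint pos t : Prop := match t with Leaf c => 0 < c | Node l r => pos l /\ pos r end.

Lemma mean_child t : mean t = (mean (child false t) + mean (child true t)) / 2.
Proof. by case: t => [c|l r] //=; lra. Qed.

Lemma child_tinv b t : child b (tinv t) = tinv (child b t).
Proof. by case: t => // l r; case: b. Qed.

Lemma tinvK : involutive tinv.
Proof. by elim=> [c|l + r] /=; [rewrite invrK|move=> -> ->]. Qed.

Lemma pos_mean t : pos t -> 0 < mean t.
Proof. elim: t => //= l IHl r IHr [/IHl + /IHr]; lra. Qed.

Lemma pos_tinv t : pos t -> pos (tinv t).
Proof. by elim: t => [c|l IHl r IHr] /=; [rewrite invr_gt0|case=> /IHl + /IHr]. Qed.

Lemma pos_child b t : pos t -> pos (child b t).
Proof. by case: t => // l r [] ; case: b. Qed.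

Lemma allsub_self P t : allsub P t -> P t.
Proof. by case: t => [c|l r] []. Qed.

Lemma allsub_child P b t : allsub P t -> allsub P (child b t).
Proof. by case: t => // l r /= [_ []]; case: b. Qed.

(* Average of [max(m, M s)^2 / s] over the interval carrying [t], where [s] is the
   step function of [t] and [M] only sees dyadic intervals inside it. *)
Fixpoint test t m := match t with
  | Leaf c => Num.max m c ^+ 2 / c
  | Node l r => (test l (Num.max m (mean t)) + test r (Num.max m (mean t))) / 2 end.

(** Truncation of [test] at depth [d]. It recurses as [maxint] does below, so that the two can be
    compared by induction on the depth. *)
Fixpoint test_upto d t m := match d with
  | 0 => Num.max m (mean t) ^+ 2 * mean (tinv t)
  | d'.+1 => (test_upto d' (child false t) (Num.max m (mean t)) +
              test_upto d' (child true t) (Num.max m (mean t))) / 2 end.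

Lemma le_maxl (m m' c : R) : m <= m' -> Num.max m c <= Num.max m' c.
Proof. by move=> mm'; rewrite ge_max !le_max mm' lexx orbT. Qed.

Lemma le_sqr_max (m m' c : R) : 0 <= m -> m <= m' ->
  Num.max m c ^+ 2 <= Num.max m' c ^+ 2.
Proof.
move=> m0 mm'; have m'0 := le_trans m0 mm'.
by apply: lerXn2r; rewrite ?nnegrE ?le_max ?m0 ?m'0// -?le_max; by exact: le_maxl.
Qed.

Lemma test_mono t m m' : pos t -> 0 <= m -> m <= m' -> test t m <= test t m'.
Proof.
elim: t m m' => [c|l IHl r IHr] m m' /=.
  move=> c0 m0 mm'; rewrite ler_pM2r ?invr_gt0//; exact: le_sqr_max.
move=> [pl pr] m0 mm'; set s := (mean l + mean r) / 2.
have h : Num.max m s <= Num.max m' s by exact: le_maxl.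
have h0 : 0 <= Num.max m s by rewrite le_max m0.
have := IHl _ _ pl h0 h; have := IHr _ _ pr h0 h; lra.
Qed.

Lemma test_upto_mono d t m m' : pos t -> 0 <= m -> m <= m' ->
  test_upto d t m <= test_upto d t m'.
Proof.
elim: d t m m' => [|d IH] t m m' /= pt m0 mm'.
  by apply: ler_wpM2r; [exact/ltW/pos_mean/pos_tinv|exact: le_sqr_max].
have h : Num.max m (mean t) <= Num.max m' (mean t) by exact: le_maxl.
have h0 : 0 <= Num.max m (mean t) by rewrite le_max m0.
have := IH _ _ _ (pos_child false pt) h0 h; have := IH _ _ _ (pos_child true pt) h0 h; lra.
Qed.

(** The running maximum never drops below its value at the root. *)
Lemma test_ge t m : pos t -> 0 <= m ->
  Num.max m (mean t) ^+ 2 * mean (tinv t) <= test t m.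
Proof.
elim: t m => [c|l IHl r IHr] m // [pl pr] m0 /=; set s := (mean l + mean r) / 2.
have h0 : 0 <= Num.max m s by rewrite le_max m0.
have := IHl _ pl h0; have := IHr _ pr h0.
have hl := pos_mean (pos_tinv pl); have hr := pos_mean (pos_tinv pr).
have H c : Num.max m s ^+ 2 <= Num.max (Num.max m s) c ^+ 2.
  by apply: lerXn2r; rewrite ?nnegrE//= le_max ?h0 ?lexx.
have := ler_wpM2r (ltW hl) (H (mean l)); have := ler_wpM2r (ltW hr) (H (mean r)).
lra.
Qed.

Lemma test_upto_le d t m : pos t -> 0 <= m -> test_upto d t m <= test t m.
Proof.
elim: d t m => [|d IH] t m pt m0 /=; first exact: test_ge.
have h0 : 0 <= Num.max m (mean t) by rewrite le_max m0.
case: t pt h0 => [c|l r] /=.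
  move=> c0 h0; have := IH (Leaf c) _ c0 h0; rewrite /= -maxA maxxx; lra.
move=> [pl pr] h0; have := IH _ _ pl h0; have := IH _ _ pr h0; lra.
Qed.

(** Pointwise, [max(m, a)^2 <= m^2 + a^2]; at a node whose mean is at least [m] the starting value
    is no longer felt. *)
Lemma test_le t m : pos t -> 0 <= m -> test t m <= m ^+ 2 * mean (tinv t) + test t 0.
Proof.
have sq (a b : R) : Num.max a b ^+ 2 <= a ^+ 2 + b ^+ 2.
  by case: (lerP a b) => _; rewrite ?lerDl ?lerDr sqr_ge0.
have sq0 (a b : R) : 0 <= b -> b ^+ 2 <= Num.max a b ^+ 2.
  by move=> b0; apply: lerXn2r; rewrite ?nnegrE//= le_max ?b0 ?lexx ?orbT.
elim: t m => [c|l IHl r IHr] m /=.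
  move=> c0 m0; rewrite -mulrDl ler_pM2r ?invr_gt0//.
  by apply: le_trans (sq _ _) _; rewrite lerD2l; exact/sq0/ltW.
move=> [pl pr] m0; set s := (mean l + mean r) / 2.
have s0 : 0 < s by have := pos_mean pl; have := pos_mean pr; rewrite /s; lra.
have -> : Num.max 0 s = s by apply/max_idPr/ltW.
have [ms|ms] := lerP m s.
  rewrite lerDr mulr_ge0// ?sqr_ge0//.
  have := pos_mean (pos_tinv pl); have := pos_mean (pos_tinv pr); lra.
have := IHl _ pl m0; have := IHr _ pr m0.
have := @test_mono l 0 s pl (lexx _) (ltW s0); have := @test_mono r 0 s pr (lexx _) (ltW s0).
lra.
Qed.

(** Joining two trees under a root costs at most the root's own term. This recursion carries testing
    bounds from subtrees to their parent. *)
Lemma test_node l r : pos (Node l r) -> test (Node l r) 0 <=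
  mean (Node l r) ^+ 2 * mean (tinv (Node l r)) + (test l 0 + test r 0) / 2.
Proof.
move=> /= [pl pr]; set s := (mean l + mean r) / 2.
have s0 : 0 < s by have := pos_mean pl; have := pos_mean pr; rewrite /s; lra.
have -> : Num.max 0 s = s by apply/max_idPr/ltW.
have := test_le pl (ltW s0); have := test_le pr (ltW s0); lra.
Qed.

Lemma test_inv_node l r : pos (Node l r) -> test (tinv (Node l r)) 0 <=
  mean (tinv (Node l r)) ^+ 2 * mean (Node l r) +
  (test (tinv l) 0 + test (tinv r) 0) / 2.
Proof.
move=> p; have := test_node (pos_tinv p : pos (Node (tinv l) (tinv r))).
by rewrite -[Node (tinv l) (tinv r)]/(tinv (Node l r)) tinvK.
Qed.

Lemma test_ge0 t m : pos t -> 0 <= m -> 0 <= test t m.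
Proof.
move=> pt m0; apply: le_trans (test_ge pt m0).
by rewrite mulr_ge0 ?sqr_ge0// ltW// pos_mean//; exact: pos_tinv.
Qed.

Lemma test_leaf a : 0 < a -> test (Leaf a) 0 = a.
Proof. by move=> a0; rewrite /= max_r ?ltW// expr2 mulfK// gt_eqF. Qed.

(** The subtree over [dyad n k]: the [n] binary digits of [k], highest first, are the turns taken
    from the root. *)
Fixpoint sub t n k := match n with
  | 0 => t | n'.+1 => child (odd k) (sub t n' k./2) end.

Lemma sub_double t n k : sub t n.+1 k.*2 = child false (sub t n k).
Proof. by rewrite /= odd_double doubleK. Qed.

Lemma sub_doubleS t n k : sub t n.+1 k.*2.+1 = child true (sub t n k).
Proof. by rewrite /= odd_double uphalf_double. Qed.

Lemma sub_tinv t n k : sub (tinv t) n k = tinv (sub t n k).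
Proof. by elim: n k => //= n IH k; rewrite IH child_tinv. Qed.

Lemma pos_sub t n k : pos t -> pos (sub t n k).
Proof. by move=> pt; elim: n k => //= n IH k; apply: pos_child. Qed.

Lemma allsub_sub P t n k : allsub P t -> P (sub t n k).
Proof.
move=> Pt; apply: allsub_self.
by elim: n k => //= n IH k; apply: allsub_child.
Qed.

(* Average of [S(a)^2 b], where [S] only sees the first [d] generations. *)
Fixpoint gain d a b := match d with
  | 0 => 0
  | d'.+1 => ((mean (child true a) - mean (child false a)) / 2) ^+ 2 * mean b +
     (gain d' (child false a) (child false b) + gain d' (child true a) (child true b)) / 2
  end.

Lemma gainS d a b : pos b -> gain d a b <= gain d.+1 a b.
Proof.
elim: d a b => [|d IH] a b pb.
  by rewrite /= addr0 mul0r addr0 mulr_ge0 ?sqr_ge0// ltW// pos_mean.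
rewrite [leLHS]/= [leRHS]/=; rewrite lerD2l ler_pM2r ?invr_gt0//.
by apply: lerD; apply: IH; exact: pos_child.
Qed.

Lemma gain_mono d d' a b : pos b -> (d <= d')%N -> gain d a b <= gain d' a b.
Proof.
move=> pb; elim: d' => [|d' IH]; first by rewrite leqn0 => /eqP ->.
by rewrite leq_eqVlt => /predU1P[->//|/IH/le_trans]; apply; exact: gainS.
Qed.

Lemma gain_ge0 d a b : pos b -> 0 <= gain d a b.
Proof. by move=> pb; exact: (@gain_mono 0). Qed.

Lemma gain_node d a1 a2 b1 b2 : pos (Node b1 b2) ->
  (gain d a1 b1 + gain d a2 b2) / 2 <= gain d.+1 (Node a1 a2) (Node b1 b2).
Proof.
by move=> pb; rewrite [leRHS]/= lerDr mulr_ge0 ?sqr_ge0//; exact/ltW/(pos_mean pb).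
Qed.

(** * Sawyer's theorem for the dyadic maximal function, by a Bellman function *)

Lemma sqr_div_convex (a b y z : R) : 0 < y -> 0 < z ->
  ((a + b) / 2) ^+ 2 / ((y + z) / 2) <= (a ^+ 2 / y + b ^+ 2 / z) / 2.
Proof.
move=> y0 z0; rewrite -subr_ge0.
have -> : (a ^+ 2 / y + b ^+ 2 / z) / 2 - ((a + b) / 2) ^+ 2 / ((y + z) / 2) =
  (a * z - b * y) ^+ 2 / (2 * y * z * (y + z)).
  by field; rewrite !gt_eqF ?addr_gt0.
by rewrite divr_ge0 ?sqr_ge0// !mulr_ge0 ?addr_ge0 ?ltW.
Qed.

(** The two denominators [y] and [z] differ by [S^2 r / T], and the Carleson hypothesis keeps both
    at most [2 S]. Hence the drop [f^2 (z - y) / (y z)] is at least [f^2 r / (4 T)]. *)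
Lemma carleson_jump (T S f l r : R) : 0 < T -> 0 < S -> 0 <= l -> 0 <= r ->
  l + S ^+ 2 * r <= T * S ->
  f ^+ 2 * r <= 4 * T * (f ^+ 2 / (S + l / T) - f ^+ 2 / (S + (l + S ^+ 2 * r) / T)).
Proof.
move=> T0 S0 l0 r0 h.
have lT : 0 <= l / T by rewrite divr_ge0// ltW.
have rT : 0 <= S ^+ 2 * r / T by rewrite divr_ge0 ?mulr_ge0 ?sqr_ge0// ltW.
set y := S + l / T; set z := S + _ / T.
have y0 : 0 < y by rewrite ltr_pwDl.
have yz : z = y + S ^+ 2 * r / T by rewrite /z /y; field; rewrite gt_eqF.
have z2 : z <= 2 * S.
  have : (l + S ^+ 2 * r) / T <= S by rewrite ler_pdivrMr// [S * T]mulrC.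
  by rewrite /z; lra.
have z0 : 0 < z by lra.
have -> : 4 * T * (f ^+ 2 / y - f ^+ 2 / z) =
  f ^+ 2 * r * (4 * S ^+ 2 / (y * z)).
  have -> : r = T * (z - y) / S ^+ 2 by rewrite yz; field; rewrite !gt_eqF.
  by clear -y0 z0 S0; clearbody y z; field; rewrite !gt_eqF.
apply: ler_peMr; first by rewrite mulr_ge0 ?sqr_ge0.
rewrite ler_pdivlMr; last by rewrite mulr_gt0.
rewrite mul1r.
have -> : 4 * S ^+ 2 = (2 * S) * (2 * S) by ring.
by apply: ler_pM; lra.
Qed.

(* [F n k] plays the role of the average of [|f|] over [dyad n k]. *)
Fixpoint maxint (F : nat -> nat -> R) v d n k m := match d with
  | 0 => Num.max m (F n k) ^+ 2 * mean (sub v n k)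
  | d'.+1 => (maxint F v d' n.+1 k.*2 (Num.max m (F n k)) +
              maxint F v d' n.+1 k.*2.+1 (Num.max m (F n k))) / 2 end.

Section maximal_bound.
(** [q] plays the average of [f^2 / s], [Fq] is the Cauchy-Schwarz inequality, and [sT] is Sawyer's
    testing condition on every subinterval. *)
Variables (F q : nat -> nat -> R) (s : tree) (T : R).
Hypotheses (T0 : 0 < T) (ps : pos s)
  (sT : allsub (fun t => test t 0 <= T * mean t) s)
  (Fmart : forall n k, (k < 2 ^ n)%N -> F n k = (F n.+1 k.*2 + F n.+1 k.*2.+1) / 2)
  (qmart : forall n k, (k < 2 ^ n)%N -> q n k = (q n.+1 k.*2 + q n.+1 k.*2.+1) / 2)
  (Fq : forall n k, (k < 2 ^ n)%N -> F n k ^+ 2 <= q n k * mean (sub s n k)).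

(* Sawyer's theorem by induction on the depth.  [r] is the average of [v] on the set
   where the maximal function of [F] stays below [m]; [l] collects the terms
   [S_I^2 v(E_I)], where [E_I] is the set on which the maximum is attained at [I].
   The last clause makes [l] a Carleson sum, and [Q - F^2 / (S + l / T)] is the
   Bellman function of the Carleson embedding theorem. *)
Lemma maxint_selection d n k m : (k < 2 ^ n)%N -> 0 <= m ->
  exists r l, [/\ 0 <= r, 0 <= l,
    maxint F (tinv s) d n k m <=
      m ^+ 2 * r + 4 * T * (q n k - F n k ^+ 2 / (mean (sub s n k) + l / T)) &
    forall u, 0 <= u -> l + u ^+ 2 * r <= test_upto d (sub s n k) u].
Proof.
elim: d n k m => [|d IH] n k m kn m0.
  have S0 := pos_mean (pos_sub n k ps).
  have V0 := pos_mean (pos_tinv (pos_sub n k ps)).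
  have FS : F n k ^+ 2 / mean (sub s n k) <= q n k by rewrite ler_pdivrMr// Fq.
  rewrite /= sub_tinv; set S := mean (sub s n k) in S0 FS *.
  set V := mean _ in V0 *.
  (* At depth 0 the whole cell counts in [r] if its average does not exceed [m], and otherwise forms
     [E_I]. *)
  have [Fm|mF] := lerP (F n k) m.
    exists V, 0; split => //; first exact: ltW.
    - by rewrite mul0r addr0 lerDl mulr_ge0 ?subr_ge0// mulr_ge0// ltW.
    - move=> u u0; rewrite add0r ler_pM2r//.
      by apply: lerXn2r; rewrite ?nnegrE//= ?le_max ?u0 ?lexx.
  have Hu u : 0 <= u -> S ^+ 2 * V <= Num.max u S ^+ 2 * V.
    move=> u0; rewrite ler_pM2r//.
    by apply: lerXn2r; rewrite ?nnegrE//= ?le_max ?u0 ?lexx ?orbT// ltW.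
  exists 0, (S ^+ 2 * V); split => //.
  - by rewrite mulr_ge0 ?sqr_ge0// ltW.
  - rewrite mulr0 add0r.
    have := @carleson_jump T S (F n k) 0 V T0 S0 (lexx _) (ltW V0).
    rewrite !add0r mul0r addr0 => /(_ _)/le_trans; apply.
      apply: le_trans (allsub_sub n k sT).
      apply: le_trans (test_ge (pos_sub n k ps) (lexx 0)).
      exact: Hu.
    by rewrite ler_pM2l ?mulr_gt0// lerD2r.
  - by move=> u u0; rewrite mulr0 addr0; exact: Hu.
have k0 : (k.*2 < 2 ^ n.+1)%N by rewrite expnS mul2n ltn_double.
have k1 : (k.*2.+1 < 2 ^ n.+1)%N by rewrite expnS mul2n ltn_Sdouble.
rewrite /=; set m' := Num.max m (F n k).
have m'0 : 0 <= m' by rewrite le_max m0.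
have [r1 [l1 [r10 l10 I1 T1]]] := IH n.+1 k.*2 m' k0 m'0.
have [r2 [l2 [r20 l20 I2 T2]]] := IH n.+1 k.*2.+1 m' k1 m'0.
move: I1 I2 T1 T2; rewrite sub_double sub_doubleS => I1 I2 T1 T2.
have S0 := pos_mean (pos_sub n k ps).
have pf := pos_child false (pos_sub n k ps); have pt := pos_child true (pos_sub n k ps).
have Sf0 := pos_mean pf; have St0 := pos_mean pt.
have Tu u : 0 <= u -> (l1 + l2) / 2 + u ^+ 2 * ((r1 + r2) / 2) <=
    test_upto d.+1 (sub s n k) u.
  move=> u0 /=; set u' := Num.max u _.
  have uu' : u <= u' by rewrite le_max lexx.
  have := T1 _ u0; have := T2 _ u0.
  have := test_upto_mono d pf u0 uu'; have := test_upto_mono d pt u0 uu'.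
  lra.
(* Joint convexity of [f^2 / y] passes the Bellman function from the two children to the parent. *)
have cvx : F n k ^+ 2 / (mean (sub s n k) + (l1 + l2) / 2 / T) <=
   (F n.+1 k.*2 ^+ 2 / (mean (child false (sub s n k)) + l1 / T) +
    F n.+1 k.*2.+1 ^+ 2 / (mean (child true (sub s n k)) + l2 / T)) / 2.
  rewrite (Fmart kn) [mean (sub s n k)]mean_child.
  have -> : (mean (child false (sub s n k)) + mean (child true (sub s n k))) / 2
     + (l1 + l2) / 2 / T = ((mean (child false (sub s n k)) + l1 / T) +
      (mean (child true (sub s n k)) + l2 / T)) / 2.
    by field; rewrite gt_eqF.
  by apply: sqr_div_convex; rewrite ltr_pwDl// divr_ge0// ltW.
have Iall : (maxint F (tinv s) d n.+1 k.*2 m' + maxint F (tinv s) d n.+1 k.*2.+1 m') / 2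
   <= m' ^+ 2 * ((r1 + r2) / 2) + 4 * T *
     (q n k - F n k ^+ 2 / (mean (sub s n k) + (l1 + l2) / 2 / T)).
  rewrite (qmart kn).
  have := ler_wpM2l (ltW T0) cvx; lra.
have [Fm|mF] := lerP (F n k) m.
  exists ((r1 + r2) / 2), ((l1 + l2) / 2); split => //; try lra.
  by move: Iall; rewrite {3}/m'; move/max_idPl: Fm => ->.
have Em' : m' = F n k by apply/max_idPr/ltW.
have Hu u : 0 <= u -> (l1 + l2) / 2 + mean (sub s n k) ^+ 2 * ((r1 + r2) / 2)
    <= test_upto d.+1 (sub s n k) u.
  move=> u0 /=; set u' := Num.max u _.
  have u'0 : 0 <= u' by rewrite le_max u0.
  have su : mean (sub s n k) <= u' by rewrite le_max lexx orbT.
  have h1 := T1 _ u'0; have h2 := T2 _ u'0.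
  have : mean (sub s n k) ^+ 2 * (r1 + r2) <= u' ^+ 2 * (r1 + r2).
    apply: ler_wpM2r; first lra.
    by apply: lerXn2r; rewrite ?nnegrE//= ltW.
  lra.
(* The average here exceeds [m]. The part on which the children stay below it becomes [E_I]: its
   mass leaves [r] and enters [l] with weight [S^2], and [carleson_jump] pays for it. *)
exists 0, ((l1 + l2) / 2 + mean (sub s n k) ^+ 2 * ((r1 + r2) / 2)); split => //.
- by rewrite addr_ge0 ?mulr_ge0 ?sqr_ge0//; lra.
- apply: le_trans Iall _; rewrite mulr0 add0r Em'.
  have r0 : 0 <= (r1 + r2) / 2 by lra.
  have l0 : 0 <= (l1 + l2) / 2 by lra.
  have := @carleson_jump T (mean (sub s n k)) (F n k) _ _ T0 S0 l0 r0.
  move=> /(_ _); set X := _ * (_ / _ - _ / _) => H.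
  suff : F n k ^+ 2 * ((r1 + r2) / 2) <= X by rewrite /X; lra.
  apply: H; apply: le_trans (allsub_sub n k sT).
  apply: le_trans (test_upto_le d.+1 (pos_sub n k ps) (lexx 0)).
  exact: Hu.
- by move=> u u0; rewrite mulr0 addr0; exact: Hu.
Qed.

Lemma maxint_le d : maxint F (tinv s) d 0 0 0 <= 4 * T * q 0 0.
Proof.
have [r [l [r0 l0 h _]]] := @maxint_selection d 0 0 0 isT (lexx _).
apply: le_trans h _; rewrite expr0n mul0r add0r ler_pM2l ?mulr_gt0// gerBl.
have S0 := pos_mean (pos_sub 0 0 ps).
by rewrite divr_ge0 ?sqr_ge0// addr_ge0 ?divr_ge0// ltW.
Qed.

End maximal_bound.

End dyadic_trees.

(** * Construction of the oscillating weight *)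

Section weight_trees.
Variable R : realType.
Local Notation tree := (tree R).

Section construction.
Variables (L : nat) (N : R).
(* [q r = N^2 / 4^r], the size of [u] times the average of the inverse in [osc u X r]. *)
Variable q : nat -> R.
Hypotheses (N4 : 4 <= N) (q0 : q 0 = N ^+ 2) (qS : forall r, q r.+1 = q r / 4)
  (qL : q L = N).

(* [tip] ends an oscillation: the average of the inverse is about [N^2 / (2 u)]. *)
Definition tip u := Node (Leaf (u / N ^+ 2)) (Leaf (2 * u - u / N ^+ 2)).

(* [r] remaining double steps around the average [u]; each of them splits off one
   copy of [X] and one half on which both the weight and its inverse are small. *)
Definition osc u X r := iter r (fun t => Node (Node t X) (Leaf (u / N))) (tip u).

(** The factor [3 - 2 / N] is forced: a double step must restore the average, that is
    [((u + x) / 2 + u / N) / 2 = u]. *)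
Fixpoint lev k u := match k with
  | 0 => Leaf u | k'.+1 => osc u (lev k' ((3 - 2 / N) * u)) L end.

Let N0 : 0 < N. Proof. by move: (N4); lra. Qed.
Let NV0 : 0 < N^-1. Proof. by rewrite invr_gt0. Qed.
Let NV : N^-1 <= 1 / 4. Proof. by rewrite -[leLHS]mul1r ler_pdivrMr//; move: (N4); lra. Qed.

Lemma q_gt0 r : 0 < q r.
Proof. by elim: r => [|r IH]; rewrite ?q0 ?exprn_gt0// qS; lra. Qed.

Lemma q_anti r s : (r <= s)%N -> q s <= q r.
Proof.
elim: s => [|s IH]; first by rewrite leqn0 => /eqP ->.
by rewrite leq_eqVlt => /predU1P[->//|/IH]; rewrite qS; move: (q_gt0 s); lra.
Qed.

Lemma q_ge r : (r <= L)%N -> N <= q r.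
Proof. by rewrite -qL; exact: q_anti. Qed.

Lemma q_le r : q r <= N ^+ 2.
Proof. by rewrite -q0; exact: q_anti. Qed.

(** Required at every subinterval: the A_2 product and Sawyer's condition for both weights. Symmetry
    under inversion lets one induction serve the weight and its inverse. *)
Definition good t := [/\ mean t * mean (tinv t) <= 3 * N ^+ 2,
  test t 0 <= 40 * N ^+ 2 * mean t &
  test (tinv t) 0 <= 40 * N ^+ 2 * mean (tinv t)].

Lemma good_tinv t : good t -> good (tinv t).
Proof. by case=> h1 h2 h3; split; rewrite ?tinvK// mulrC. Qed.

Lemma allsub_good_tinv t : allsub good t -> allsub good (tinv t).
Proof.
elim: t => [c|l IHl r IHr] [/good_tinv h]; first by split.
by case=> /IHl hl /IHr hr; split.
Qed.

Lemma good_leaf c : 0 < c -> good (Leaf c).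
Proof.
move=> c0; have cV : 0 < c^-1 by rewrite invr_gt0.
have N2 : 16 <= N ^+ 2 by move: (N4); nra.
split; rewrite /= ?mulfV ?gt_eqF//; first lra.
- have -> : Num.max 0 c = c by apply/max_idPr/ltW.
  rewrite expr2 mulfK ?gt_eqF//; nra.
- have -> : Num.max 0 c^-1 = c^-1 by apply/max_idPr/ltW.
  rewrite expr2 mulfK ?invr_eq0 ?gt_eqF//; nra.
Qed.

(** * Estimates for one level of oscillation *)

Section oscillation.
(** [X] is the next level. The hypotheses are what the induction over levels proves about it, with
    [c] the constant of its testing bound. *)
Variables (u c : R) (X : tree).
Hypotheses (u0 : 0 < u) (pX : pos X) (mX : mean X = (3 - 2 / N) * u)
  (vX : (3 - 2 / N) * u * mean (tinv X) <= 2 * N)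
  (c0 : 0 <= c) (cN : c <= 16 * N ^+ 2)
  (tX : test X (3 * ((3 - 2 / N) * u)) <= c * ((3 - 2 / N) * u))
  (sX : (3 - 2 / N) * u * test (tinv X) 0 <= 11 * N ^+ 3)
  (gX : allsub good X)
  (gX' : test (tinv X) 0 <= 22 * N ^+ 2 * mean (tinv X)).

Let uN : 0 < u / N. Proof. by rewrite divr_gt0. Qed.

Let N2u : 0 < u / N ^+ 2. Proof. by rewrite divr_gt0 ?exprn_gt0. Qed.

Let N2u' : u / N ^+ 2 <= u / 16.
Proof. rewrite ler_pM2l// lef_pV2 ?posrE ?exprn_gt0//; move: (N4); nra. Qed.

Lemma pos_osc r : pos (osc u X r).
Proof. by elim: r => [|r IH] //=; split => //; move: (u0) N2u'; lra. Qed.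

Lemma mean_osc r : mean (osc u X r) = u.
Proof.
elim: r => [|r IH] /=; first by field; rewrite gt_eqF.
by rewrite -/(osc u X r) IH mX; field; rewrite gt_eqF.
Qed.

Let V r := mean (tinv (osc u X r)).

Let VS r : u * V r.+1 = u * V r / 4 + u * mean (tinv X) / 4 + N / 2.
Proof. by rewrite {1}/V /= -/(osc u X r) -/(V r); field; rewrite !gt_eqF. Qed.

Let VX0 : 0 < mean (tinv X). Proof. exact/pos_mean/pos_tinv. Qed.

Let uVX : u * mean (tinv X) <= 4 / 5 * N.
Proof. have := mulr_gt0 u0 VX0; move: (vX) (NV); nra. Qed.

Lemma inv_tip : u * V 0 = N ^+ 2 / 2 + u / (2 * u - u / N ^+ 2) / 2.
Proof. by rewrite /V /= mulrA mulrDr mulrDl invf_div mulrCA divff ?gt_eqF// mulr1. Qed.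

Let tip_bnd : 0 < u / (2 * u - u / N ^+ 2) <= 1.
Proof.
have D : u <= 2 * u - u / N ^+ 2 by move: (u0) N2u'; lra.
by rewrite ler_pdivrMr ?divr_gt0 ?mul1r// (lt_le_trans u0 D).
Qed.

(** In the recursion [VS] an error [N] turns into at most [N / 4 + N / 5 + N / 2], coming from the
    remaining oscillation, from [X] and from the small leaf; this is again below [N]. *)
Lemma inv_osc_le r : u * V r <= q r + N.
Proof.
elim: r => [|r IH]; last by rewrite VS qS; move: IH uVX N0; lra.
by rewrite inv_tip q0; case/andP: tip_bnd; move: (u / _) (N4) => z; nra.
Qed.

Lemma inv_osc_ge r : q r / 2 <= u * V r.
Proof.
elim: r => [|r IH]; last by rewrite VS qS; move: IH N0 (mulr_gt0 u0 VX0); lra.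
by rewrite inv_tip q0; case/andP: tip_bnd; move: (u / _) => z; lra.
Qed.

Let V0 r : 0 < V r. Proof. exact/pos_mean/pos_tinv/pos_osc. Qed.

Let u3 : u <= 3 * u. Proof. by move: (u0); lra. Qed.

Let NVu : 0 <= 2 / N * u <= u / 2.
Proof. by apply/andP; split; move: (u0) NV0 NV; nra. Qed.

Let tX3 : test X (3 * u) <= 3 * c * u.
Proof.
have h : 0 <= 3 * u by move: (u0); lra.
have h' : 3 * u <= 3 * ((3 - 2 / N) * u) by case/andP: NVu; lra.
apply: le_trans (test_mono pX h h') (le_trans tX _).
by case/andP: NVu; move: (c0); nra.
Qed.

(** No average met before [X] is entered, nor the mean of [X], exceeds [3 * u], so the maximum stays
    frozen there. The bound then evolves by [T -> T / 4 + 3 c / 4 + 9 N / 2], whose fixed point is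
    [c + 6 N]. *)
Lemma test_osc r : test (osc u X r) (3 * u) <= (9 * q r + c + 6 * N) * u.
Proof.
elim: r => [|r IH].
  have -> : test (osc u X 0) (3 * u) = 9 * u * (u * V 0).
    rewrite /V /= !max_l; [|by move: (u0) N2u' N2u; lra..].
    by rewrite !exprMn; ring.
  rewrite inv_tip q0; set z := u / _; have z1 : z <= 1 by case/andP: tip_bnd.
  rewrite [leRHS]mulrC -mulrA [leLHS]mulrCA ler_pM2l//.
  by move: (c0) (N4); nra.
have NVu' := NVu; case/andP: NVu' => NVu1 NVu2.
rewrite /= -/(osc u X r) mean_osc mX.
have uNu : u / N <= u by rewrite ler_pdivrMr//; move: (u0) (N4); nra.
rewrite (max_l (x := 3 * u)); last by move: (u0); lra.
rewrite (max_l (x := 3 * u)); last by move: (u0); lra.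
rewrite (max_l (x := 3 * u)); last by move: (u0); lra.
have -> : (3 * u) ^+ 2 / (u / N) = 9 * N * u by field; rewrite !gt_eqF.
by move: IH tX3; rewrite qS; lra.
Qed.

Let mean_inner r : mean (Node (osc u X r) X) = (2 - 1 / N) * u.
Proof. by rewrite /= mean_osc mX; field; rewrite gt_eqF. Qed.

Let VSinner r : mean (tinv (Node (osc u X r) X)) <= 2 * V r.+1.
Proof.
rewrite /V /= -/(osc u X r) -/(V r).
have : 0 < (u / N)^-1 by rewrite invr_gt0.
by move: ((u / N)^-1) => z; lra.
Qed.

(** The averages of the inverse grow about fourfold per double step, so their squares sum
    geometrically. The term [- 7 q^2] is what closes the induction: the two new averages cost at
    most [5 / 4 q r ^+ 2], and [- 7 / 4 + 5 / 4 = - 1 / 2] lies below [- 7 / 16]. *)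
Lemma test_inv_osc r : (r <= L)%N ->
  u * test (tinv (osc u X r)) 0 <= 9 * N ^+ 2 * q r + 2 * N ^+ 3 - 7 * q r ^+ 2.
Proof.
elim: r => [_|r IH rL].
  have : test (tinv (osc u X 0)) 0 <= V 0 ^+ 2 * mean (osc u X 0) +
      (test (Leaf (u / N ^+ 2)^-1) 0 + test (Leaf (2 * u - u / N ^+ 2)^-1) 0) / 2.
    exact: (test_inv_node (pos_osc 0)).
  rewrite mean_osc !test_leaf ?invr_gt0; [|by move: (u0) N2u' N2u; lra..].
  have -> : ((u / N ^+ 2)^-1 + (2 * u - u / N ^+ 2)^-1) / 2 = V 0 by [].
  move=> /(ler_wpM2l (ltW u0))/le_trans; apply.
  have -> : u * (V 0 ^+ 2 * u + V 0) = (u * V 0) ^+ 2 + u * V 0 by ring.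
  have : u * V 0 <= N ^+ 2 / 2 + 1 / 2.
    by rewrite inv_tip; case/andP: tip_bnd; move: (u / _) => z; lra.
  rewrite q0; have := mulr_gt0 u0 (V0 0); move: (u * V 0) (N4) => v n4 v0 vN.
  have : 16 <= N ^+ 2 by nra.
  move=> n16; have : v ^+ 2 <= (N ^+ 2 / 2 + 1 / 2) ^+ 2 by apply: lerXn2r; rewrite ?nnegrE//; lra.
  have : 0 <= N ^+ 3 by rewrite exprn_ge0//; lra.
  move: vN n16; move: (N ^+ 2) (N ^+ 3) => n m vN n16 m0 h.
  have : 16 * n <= n ^+ 2 by rewrite expr2 ler_wpM2r//; lra.
  by lra.
have pI : pos (Node (osc u X r) X) by split => //; exact: pos_osc.
have h1 : test (tinv (osc u X r.+1)) 0 <= V r.+1 ^+ 2 * mean (osc u X r.+1) +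
    (test (tinv (Node (osc u X r) X)) 0 + test (Leaf (u / N)^-1) 0) / 2.
  exact: (test_inv_node (pos_osc r.+1)).
have h2 := test_inv_node pI.
rewrite mean_osc test_leaf ?invr_gt0// in h1; rewrite mean_inner in h2.
have I0 := pos_mean (pos_tinv pI).
have uNE : u * (u / N)^-1 = N by field; rewrite !gt_eqF.
move: h1 h2 I0 uNE (VSinner r) (IH (ltnW rL)) sX (inv_osc_le r.+1).
move: (test (tinv (osc u X r.+1)) 0) (test (tinv (Node _ X)) 0) => t1 t2.
move: (mean (tinv (Node _ X))) ((u / N)^-1) => y b.
have := test_ge0 (pos_tinv pX) (lexx 0).
move: (test (tinv (osc _ _ _)) 0) (test (tinv X) 0) (V0 r.+1) => t3 t4.
have := q_ge rL; rewrite qS; move: (q r) (V r.+1) => p v.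
move=> Np v0 t40 h1 h2 y0 uNE yv h3 h4 uv.
have {}h1 : u * t1 <= (u * v) ^+ 2 + (u * t2 + N) / 2.
  by move: (ler_wpM2l (ltW u0) h1) uNE; lra.
have {}h2 : u * t2 <= 2 * (u * y) ^+ 2 + (u * t3 + u * t4) / 2.
  have : 0 <= N^-1 * (u * y) ^+ 2 by rewrite mulr_ge0 ?sqr_ge0// ltW.
  by move: (ler_wpM2l (ltW u0) h2); lra.
have {}h4 : u * t4 <= 22 / 5 * N ^+ 3.
  move: h4 (mulr_ge0 (ltW u0) t40); rewrite -mulrA; move: (u * t4) => a h4 a0.
  by move: (ler_wpM2r a0 NV) h4; lra.
have uv0 : 0 <= u * v by rewrite mulr_ge0 ?ltW.
have uy0 : 0 <= u * y by rewrite mulr_ge0 ?ltW.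
(* Here [p / 4] is [q r.+1], which dominates the error [N] because [r.+1 <= L]. *)
have uv2 : (u * v) ^+ 2 <= (2 * (p / 4)) ^+ 2.
  by apply: lerXn2r; rewrite ?nnegrE; move: N0; lra.
have uy2 : (u * y) ^+ 2 <= (4 * (p / 4)) ^+ 2.
  by apply: lerXn2r; rewrite ?nnegrE; move: (ler_wpM2l (ltW u0) yv) N0; lra.
have NN : N <= p ^+ 2 / 16 by move: (N4); nra.
have N30 : 0 <= N ^+ 3 by rewrite exprn_ge0// ltW.
by move: N0; lra.
Qed.

Let uVle r : u * V r <= 2 * N ^+ 2.
Proof. by move: (inv_osc_le r) (q_le r) (N4); nra. Qed.

(** As [N <= q r], the previous bound is at most [11 N^2 q r], and [q r <= 2 u V r] by
    [inv_osc_ge]. *)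
Lemma test_inv_osc_le r : (r <= L)%N ->
  test (tinv (osc u X r)) 0 <= 22 * N ^+ 2 * V r.
Proof.
move=> rL; rewrite -(ler_pM2l u0); apply: le_trans (test_inv_osc rL) _.
move: (ler_wpM2l (sqr_ge0 N) (inv_osc_ge r)) (ler_wpM2l (sqr_ge0 N) (q_ge rL)).
by move: (sqr_ge0 (q r)); lra.
Qed.

Lemma good_osc r : (r <= L)%N -> good (osc u X r).
Proof.
move=> rL; split; rewrite ?mean_osc -/(V r).
- by move: (uVle r) (sqr_ge0 N); lra.
- apply: le_trans (test_mono (pos_osc r) (lexx _) (le_trans (ltW u0) u3)) _.
  apply: le_trans (test_osc r) _; rewrite ler_pM2r//.
  by move: (q_le r) cN (N4); nra.
- apply: le_trans (test_inv_osc_le rL) _; rewrite ler_pM2r//.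
  by move: (sqr_ge0 N); lra.
Qed.

(** Halfway through a double step the average is [(2 - 1 / N) u]; that interval is dyadic too and
    needs its own check. *)
Lemma good_inner r : (r <= L)%N -> good (Node (osc u X r) X).
Proof.
move=> rL; have pI : pos (Node (osc u X r) X) by split => //; exact: pos_osc.
have u30 : 0 <= 3 * u by move: (u0); lra.
have I0 := pos_mean (pos_tinv pI).
have IE : u * mean (tinv (Node (osc u X r) X)) = (u * V r + u * mean (tinv X)) / 2.
  by rewrite /= -/(V r); ring.
have W2 : 7 / 4 * u <= (2 - 1 / N) * u <= 2 * u.
  by rewrite !ler_pM2r// mul1r; apply/andP; split; move: NV NV0; lra.
have A2 : mean (Node (osc u X r) X) * mean (tinv (Node (osc u X r) X)) <= 3 * N ^+ 2.
  rewrite mean_inner; apply: (@le_trans _ _ (2 * u * mean (tinv (Node (osc u X r) X)))).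
    by rewrite ler_pM2r//; case/andP: W2.
  rewrite -mulrA IE; move: (inv_osc_le r) (q_le r) uVX (N4).
  by move: (u * V r) (u * mean _) => a b; nra.
split => //.
- apply: le_trans (test_mono pI (lexx _) u30) _; rewrite mean_inner.
  have -> : test (Node (osc u X r) X) (3 * u) =
      (test (osc u X r) (3 * u) + test X (3 * u)) / 2.
    rewrite [LHS]/= -[(mean _ + mean _) / 2]/(mean (Node (osc u X r) X)) mean_inner.
    by rewrite max_l//; case/andP: W2 => _; move: (u0); lra.
  have h : (9 * q r + c + 6 * N) * u <= 27 * N ^+ 2 * u.
    by rewrite ler_pM2r//; move: (q_le r) cN (N4); nra.
  have h' : 3 * c * u <= 48 * N ^+ 2 * u by rewrite ler_pM2r//; move: cN; lra.
  have : 40 * N ^+ 2 * (7 / 4 * u) <= 40 * N ^+ 2 * ((2 - 1 / N) * u).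
    by rewrite ler_pM2l ?mulr_gt0 ?exprn_gt0//; case/andP: W2.
  have := mulr_ge0 (sqr_ge0 N) (ltW u0).
  by move: h h' (test_osc r) tX3; lra.
- apply: le_trans (test_inv_node pI) _.
  have := ler_wpM2r (ltW I0) A2; have := test_inv_osc_le rL; have := gX'.
  rewrite -/(V r); move: (mulr_ge0 (sqr_ge0 N) (ltW I0)); rewrite /= -/(osc u X r) -/(V r).
  by move: (test _ _) (test _ _) => a b; lra.
Qed.

Lemma allsub_osc r : (r <= L)%N -> allsub good (osc u X r).
Proof.
elim: r => [|r IH] rL.
  split; first exact: (good_osc rL).
  by split; split => //; apply: good_leaf; move: (u0) N2u' N2u; lra.
split; first exact: (good_osc rL).
split; split => //; last exact: good_leaf.
- exact/good_inner/ltnW.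
- by split => //; exact/IH/ltnW.
Qed.

(** A double step divides both earlier gains and [q] by 4, so the [r] steps contribute equally,
    whence [r * q r]. The copies of [X] fill the fraction [1/4 + ... + 1/4^r = (1 - 4^-r) / 3] of
    the interval. *)
Lemma gain_osc g d0 : g * ((3 - 2 / N) * u) <= gain d0 X (tinv X) ->
  forall r, exists d, (9 / 32 * r%:R * q r + (1 - q r / N ^+ 2) / 3 * (3 - 2 / N) * g) * u
    <= gain d (osc u X r) (tinv (osc u X r)).
Proof.
move=> gX0; elim=> [|r [d IH]].
  by exists 0%N; rewrite q0 divff ?expf_neq0 ?gt_eqF// mulr0 !mul0r subrr !mul0r addr0 mul0r.
exists (maxn d d0).+2.
have h1 := le_trans IH (gain_mono (osc u X r) (pos_tinv (pos_osc r)) (leq_maxl d d0)).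
have h2 := le_trans gX0 (gain_mono X (pos_tinv pX) (leq_maxr d d0)).
have pB : pos (tinv (Leaf (u / N))) by rewrite /= invr_gt0.
have h3 := gain_ge0 (maxn d d0).+1 (Leaf (u / N)) pB.
have h4 : gain (maxn d d0).+2 (osc u X r.+1) (tinv (osc u X r.+1)) =
  ((u / N - mean (Node (osc u X r) X)) / 2) ^+ 2 * V r.+1 +
  (gain (maxn d d0).+1 (Node (osc u X r) X) (tinv (Node (osc u X r) X)) +
   gain (maxn d d0).+1 (Leaf (u / N)) (tinv (Leaf (u / N)))) / 2 by [].
have h5 : gain (maxn d d0).+1 (Node (osc u X r) X) (tinv (Node (osc u X r) X)) =
  ((mean X - mean (osc u X r)) / 2) ^+ 2 * mean (tinv (Node (osc u X r) X)) +
  (gain (maxn d d0) (osc u X r) (tinv (osc u X r)) + gain (maxn d d0) X (tinv X)) / 2.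
  by [].
have h6 : 0 <= ((mean X - mean (osc u X r)) / 2) ^+ 2 * mean (tinv (Node (osc u X r) X)).
  apply: mulr_ge0; first exact: sqr_ge0.
  by apply/ltW/pos_mean/pos_tinv; split => //; exact: pos_osc.
(* [9 / 32 = (3 / 4)^2 / 2], from [1 - 1 / N >= 3 / 4] and [u V >= q / 2]. Of the inner difference
   only the sign is used. *)
have h7 : 9 / 32 * q r.+1 * u <=
    ((u / N - mean (Node (osc u X r) X)) / 2) ^+ 2 * V r.+1.
  rewrite mean_inner.
  have -> : ((u / N - (2 - 1 / N) * u) / 2) ^+ 2 * V r.+1 =
     (1 - N^-1) ^+ 2 * (u * (u * V r.+1)).
    by move: (V r.+1) => v; field; rewrite gt_eqF.
  have : (3 / 4) ^+ 2 <= (1 - N^-1) ^+ 2.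
    by apply: lerXn2r; rewrite ?nnegrE; move: (NV); lra.
  have := ler_wpM2l (ltW u0) (inv_osc_ge r.+1).
  have : 0 <= u * (u * V r.+1) by exact: (mulr_ge0 (ltW u0) (mulr_ge0 (ltW u0) (ltW (V0 _)))).
  move: (u * (u * V r.+1)) ((1 - N^-1) ^+ 2) => x y x0 h y0.
  by move: (ler_wpM2r x0 y0) h; lra.
rewrite h4 h5; move: h1 h2 h3 h6 h7; rewrite qS -[r.+1%:R]natr1.
move: (gain _ _ _) (gain _ X _) (gain _ (Leaf _) _) (_ ^+ 2 * mean _) (_ ^+ 2 * V _).
move=> a b c' x y; move: (N ^+ 2)^-1 N^-1 => n2 n1; lra.
Qed.

End oscillation.

(** * Stacking the levels *)

Lemma lev_props (k : nat) (u : R) : 0 < u -> k%:R <= N ->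
  [/\ pos (lev k u), mean (lev k u) = u, u * mean (tinv (lev k u)) <= 2 * N,
    allsub good (lev k u) &
  [/\ test (lev k u) (3 * u) <= (15 * k%:R * N + N ^+ 2) * u,
    u * test (tinv (lev k u)) 0 <= 11 * N ^+ 3 &
    test (tinv (lev k u)) 0 <= 22 * N ^+ 2 * mean (tinv (lev k u))]].
Proof.
elim: k u => [|k IH] u u0 kN.
  have uV : u / u = 1 by rewrite divff// gt_eqF.
  have u1 : 0 < u^-1 by rewrite invr_gt0.
  have N2 : 16 <= N ^+ 2 by move: (N4); nra.
  have N3 : 1 <= N ^+ 3 by apply: exprn_ege1; move: (N4); lra.
  split=> //; last split.
  - by rewrite /= uV; move: (N4); lra.
  - by split => //; exact: good_leaf.
  - rewrite /= max_l; last by lra.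
    have -> : (3 * u) ^+ 2 / u = 9 * u by field; rewrite gt_eqF.
    by rewrite ler_pM2r// mulr0 mul0r; lra.
  - by rewrite [tinv _]/= test_leaf// uV; lra.
  - by rewrite [tinv _]/= test_leaf// ler_peMl ?ltW//; lra.
have e3 : 5 / 2 <= 3 - 2 / N by move: NV; lra.
have u'0 : 0 < (3 - 2 / N) * u by rewrite mulr_gt0//; lra.
have kN' : k%:R <= N by apply: le_trans kN; rewrite ler_nat.
have [pX mX vX gX [tX sX gX']] := IH _ u'0 kN'.
have c0 : 0 <= 15 * k%:R * N + N ^+ 2 by rewrite addr_ge0 ?sqr_ge0// !mulr_ge0// ltW.
(* One level adds [9 q L + 6 N = 15 N] to the testing constant, so up to [N] levels keep it within
   [16 N^2]. *)
have cN : 15 * k%:R * N + N ^+ 2 <= 16 * N ^+ 2.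
  by rewrite expr2; move: (ler_wpM2r (ltW N0) kN'); lra.
split; last split.
- exact: pos_osc.
- exact: mean_osc.
- by move: (inv_osc_le u0 pX vX L); rewrite qL /=; lra.
- exact: (allsub_osc u0 pX mX vX c0 cN tX sX gX gX' (leqnn L)).
- move: (test_osc u0 pX mX c0 tX L); rewrite qL -[k.+1%:R]natr1 /=; lra.
- apply: le_trans (test_inv_osc u0 pX mX vX sX (leqnn L)) _.
  by rewrite qL; move: (sqr_ge0 N); rewrite !exprS !expr0; lra.
- exact: (test_inv_osc_le u0 pX mX vX sX (leqnn L)).
Qed.

(** A new level brings [9 / 32 L N] and scales the old gain by at least [1 - 2 / N]. As [k <= N],
    this loses at most [6 / 32 L N], leaving [3 / 32 L N] per level. *)
Lemma gain_lev k u : 0 < u -> k%:R <= N -> exists d,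
  3 / 32 * L%:R * N * k%:R * u <= gain d (lev k u) (tinv (lev k u)).
Proof.
elim: k u => [|k IH] u u0 kN; first by exists 0%N; rewrite mulr0 mul0r.
have e3 : 5 / 2 <= 3 - 2 / N by move: NV; lra.
have u'0 : 0 < (3 - 2 / N) * u by rewrite mulr_gt0//; lra.
have kN' : k%:R <= N by apply: le_trans kN; rewrite ler_nat.
have [pX mX vX gX [tX sX gX']] := lev_props u'0 kN'.
have [d0 h0] := IH _ u'0 kN'.
have [d hd] := gain_osc u0 pX mX h0 L.
exists d; apply: le_trans hd; rewrite ler_pM2r// qL -[k.+1%:R]natr1.
have -> : N / N ^+ 2 = N^-1 by rewrite expr2 invfM mulrA divff ?gt_eqF// mul1r.
set x := L%:R; have x0 : 0 <= x by rewrite ler0n.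
have h1 : 1 - 2 * N^-1 <= (1 - N^-1) / 3 * (3 - 2 / N).
  by move: (mulr_ge0 (ltW NV0) (ltW NV0)) NV0; lra.
have h2 : 0 <= 3 / 32 * x * N * k%:R by rewrite mulr_ge0 ?ler0n// mulr_ge0 ?(ltW N0)// mulr_ge0//; lra.
have h3 : N^-1 * (N * k%:R) <= N by rewrite mulrA mulVf ?mul1r// gt_eqF.
have := ler_wpM2r h2 h1; have := ler_wpM2l x0 h3.
move: ((1 - N^-1) / 3 * _ * _) => z; move: (N^-1) => e; lra.
Qed.

End construction.
(** [43 = 40 + 3]: placing a tree beside its inverse creates one new root, whose own term is
    controlled by the A_2 bound. *)
Definition good_weight (K : R) t := [/\ mean t * mean (tinv t) <= 3 * K,
  test t 0 <= 43 * K * mean t & test (tinv t) 0 <= 43 * K * mean (tinv t)].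

Lemma allsub_good_weight_tinv K t :
  allsub (good_weight K) t -> allsub (good_weight K) (tinv t).
Proof.
have h u : good_weight K u -> good_weight K (tinv u).
  by case=> h1 h2 h3; split; rewrite ?tinvK// mulrC.
elim: t => [c|l IHl r IHr] [/h gt]; first by split.
by case=> /IHl gl /IHr gr; split.
Qed.

Lemma allsub_impl (P Q : tree -> Prop) (t : tree) : (forall s, pos s -> P s -> Q s) ->
  pos t -> allsub P t -> allsub Q t.
Proof.
move=> PQ; elim: t => [c|l IHl r IHr] /=; first by move=> c0 [/PQ]; split; auto.
move=> [pl pr] [/PQ h [/(IHl pl) hl /(IHr pr) hr]]; split=> //; exact: h.
Qed.

Lemma sub0 (t : tree) n : sub t n 0 = iter n (child false) t.
Proof. by elim: n => //= n ->. Qed.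

Lemma iter_child_osc (N u : R) X r : iter r.*2 (child false) (osc N u X r) = tip N u.
Proof. by elim: r => // r IH; rewrite doubleS !iterSr. Qed.

Lemma exists_weight_tree (L : nat) (N : R := 4 ^+ L) : (0 < L)%N -> exists t : tree,
  [/\ pos t, mean t = 1, allsub (good_weight (N ^+ 2)) (Node t (tinv t)),
    exists n, N ^+ 2 / 2 <= mean (sub (Node t (tinv t)) n 0) *
                            mean (tinv (sub (Node t (tinv t)) n 0)) &
    exists d, 3 / 32 * L%:R * N ^+ 2 <= gain d t (tinv t)].
Proof.
move=> L0; pose q r := N ^+ 2 / 4 ^+ r.
have N4 : 4 <= N.
  rewrite /N; case: L L0 {q N} => // l _; rewrite exprS.
  by apply: ler_peMr => //; apply: exprn_ege1; lra.
have NE : N = (4 ^ L)%:R by rewrite natrX.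
have q0 : q 0 = N ^+ 2 by rewrite /q expr0 divr1.
have qS r : q r.+1 = q r / 4 by rewrite /q [X in _ / X]exprSr invfM mulrA.
have qL : q L = N by rewrite /q expr2 mulfK// gt_eqF// exprn_gt0.
clearbody N q; have N0 : 0 < N by lra.
pose k := (4 ^ L)%N; have kN : k%:R <= N by rewrite NE.
have [pt mt vt gt [_ _ _]] := lev_props N4 q0 qS qL ltr01 kN.
exists (lev L N k 1); split => //.
- rewrite mul1r in vt.
  have pit := pos_tinv pt; have V0 := pos_mean pit.
  have good_imp s : pos s -> good N s -> good_weight (N ^+ 2) s.
    move=> ps [h1 h2 h3]; split => //.
      apply: le_trans h2 _; rewrite ler_pM2r ?pos_mean//; move: (sqr_ge0 N); lra.
    apply: le_trans h3 _; rewrite ler_pM2r ?pos_mean//; last exact: pos_tinv.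
    move: (sqr_ge0 N); lra.
  split; last first.
    by split; [exact: allsub_impl good_imp pt gt|
      exact: allsub_impl good_imp pit (allsub_good_tinv gt)].
  have [_ t1 t2] := allsub_self gt.
  have pW : pos (Node (lev L N k 1) (tinv (lev L N k 1))) by split.
  have h1 := test_node pW; have h2 := test_inv_node pW.
  have mW : mean (Node (lev L N k 1) (tinv (lev L N k 1))) =
    (1 + mean (tinv (lev L N k 1))) / 2 by rewrite /= mt.
  have mW' : mean (tinv (Node (lev L N k 1) (tinv (lev L N k 1)))) =
    (1 + mean (tinv (lev L N k 1))) / 2 by rewrite /= tinvK mt addrC.
  move: h1 h2 t1 t2; rewrite /good_weight mW mW' mt tinvK.
  move: (test (Node _ _) _) (test (tinv (Node _ _)) _) => x y.
  move: (mean (tinv _)) (test _ _) (test (tinv _) _) V0 vt => v a b v0 vN h1 h2 h3 h4.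
  set s := (1 + v) / 2 in h1 h2 *.
  have s0 : 0 < s by rewrite /s; lra.
  have sN : s ^+ 2 <= 3 * N ^+ 2 by rewrite /s; nra.
  have : s ^+ 2 * s <= 3 * N ^+ 2 * s by rewrite ler_pM2r.
  have : (40 * N ^+ 2 * 1 + 40 * N ^+ 2 * v) / 2 = 40 * N ^+ 2 * s by rewrite /s; field.
  by split; lra.
(* One turn into the left half, then [L] double steps to the left, reach the tip of the first level,
   where the A_2 product is largest in order. *)
- exists (L.*2).+1; rewrite sub0 iterSr [child _ _]/=.
  have -> : k = k.-1.+1 by rewrite prednK// expn_gt0.
  rewrite iter_child_osc -[tip N 1]/(osc N 1 (lev L N k.-1 ((3 - 2 / N) * 1)) 0).
  have kN' : k.-1%:R <= N by apply: le_trans kN; rewrite ler_nat leq_pred.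
  have u0 : 0 < (3 - 2 / N) * 1.
    have : N^-1 <= 1 / 4 by rewrite -[leLHS]mul1r ler_pdivrMr//; lra.
    by rewrite mulr1; lra.
  have [pX mX vX _ _] := lev_props N4 q0 qS qL u0 kN'.
  have := inv_osc_ge N4 q0 qS ltr01 pX 0.
  by rewrite q0 (mean_osc N4) //.
- have [d hd] := gain_lev N4 q0 qS qL ltr01 kN.
  exists d; apply: le_trans hd; rewrite mulr1 -NE expr2; lra.
Qed.

End weight_trees.

(** * Trees as step functions on dyadic intervals *)

Section step_functions.
Variable R : realType.
Local Notation mu := (@lebesgue_measure R).
Local Notation tree := (tree R).
Local Notation dyad := (@dyad R).
Implicit Types (t : tree) (x : R).

Definition mid n k : R := k.*2.+1%:R / 2 ^+ n.+1.

(* The step function of [t] placed on [dyad n k]. *)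
Fixpoint ev t n k x := match t with
  | Leaf c => c
  | Node l r => if x < mid n k then ev l n.+1 k.*2 x else ev r n.+1 k.*2.+1 x end.

Lemma pow2_gt0 n : 0 < 2 ^+ n :> R. Proof. by rewrite exprn_gt0. Qed.

Lemma dyadE n k x : dyad n k x <-> k%:R <= x * 2 ^+ n < k.+1%:R.
Proof. by rewrite /Defs.dyad /= in_itv /= ler_pdivrMr ?pow2_gt0// ltr_pdivlMr ?pow2_gt0. Qed.

Lemma midE n k x : (x < mid n k) = (x * 2 ^+ n.+1 < k.*2.+1%:R).
Proof. by rewrite /mid ltr_pdivlMr ?pow2_gt0. Qed.

Lemma natr_double k : k.*2%:R = 2 * k%:R :> R.
Proof. by rewrite -mul2n natrM. Qed.

Lemma dyad_left n k x : dyad n.+1 k.*2 x <-> dyad n k x /\ x < mid n k.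
Proof.
rewrite !dyadE midE exprS mulrCA -![_.+1%:R]natr1 natr_double.
move: (x * 2 ^+ n) (k%:R : R) => y z; split.
  by move=> /andP[h1 h2]; split; [apply/andP; split|]; lra.
by move=> [/andP[h1 h2] h3]; apply/andP; split; lra.
Qed.

Lemma dyad_right n k x : dyad n.+1 k.*2.+1 x <-> dyad n k x /\ ~~ (x < mid n k).
Proof.
rewrite !dyadE midE -leNgt exprS mulrCA -![_.+1%:R]natr1 natr_double.
move: (x * 2 ^+ n) (k%:R : R) => y z; split.
  by move=> /andP[h1 h2]; split; [apply/andP; split|]; lra.
by move=> [/andP[h1 h2] h3]; apply/andP; split; lra.
Qed.

Lemma dyad_split n k : dyad n k = dyad n.+1 k.*2 `|` dyad n.+1 k.*2.+1.
Proof.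
apply/seteqP; split => x /=.
  by move=> nk; case: (boolP (x < mid n k)) => h; [left; apply/dyad_left|right; apply/dyad_right].
by case=> [/dyad_left[]|/dyad_right[]].
Qed.

Lemma dyad_disj n k : [disjoint dyad n.+1 k.*2 & dyad n.+1 k.*2.+1].
Proof.
by apply/disj_setPS => x [/dyad_left[_ h] /dyad_right[_]]; rewrite h.
Qed.

Lemma dyad_inj n k k' x : dyad n k x -> dyad n k' x -> k = k'.
Proof.
move=> /dyadE/andP[h1 h2] /dyadE/andP[h3 h4]; apply/eqP.
rewrite eqn_leq; apply/andP; split; rewrite -ltnS -(ltr_nat R).
  exact: le_lt_trans h1 h4.
exact: le_lt_trans h3 h2.
Qed.

Lemma measurable_dyad n k : measurable (dyad n k).
Proof. exact: measurable_itv. Qed.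

Lemma I0_dyad : I0 = dyad 0 0.
Proof. by rewrite /I0 /Defs.dyad expr0 !divr1. Qed.

Lemma dyad_parent n k : dyad n.+1 k `<=` dyad n k./2.
Proof.
move=> x; rewrite -{1}[k]odd_double_half; case: (odd k).
  by rewrite add1n => /dyad_right[].
by rewrite add0n => /dyad_left[].
Qed.

Lemma half_lt n k : (k < 2 ^ n.+1)%N -> (k./2 < 2 ^ n)%N.
Proof. by rewrite expnS mul2n ltn_half_double. Qed.

Lemma dyad_sub n k : (k < 2 ^ n)%N -> dyad n k `<=` I0.
Proof.
rewrite I0_dyad; elim: n k => [|n IH] k; first by rewrite expn0 ltnS leqn0 => /eqP ->.
by move=> /half_lt/IH h; exact: subset_trans (@dyad_parent n k) h.
Qed.

Lemma mu_dyad n k : mu (dyad n k) = (2 ^- n)%:E.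
Proof.
rewrite lebesgue_measure_itv /= lte_fin ltr_pM2r ?invr_gt0 ?pow2_gt0// ltr_nat ltnSn.
by rewrite -EFinD -mulrBl -natrB// subSnn mul1r.
Qed.

Lemma len_dyad n k : len (dyad n k) = 2 ^- n.
Proof. by rewrite /len mu_dyad. Qed.

Lemma measurable_ev t n k D : measurable_fun D (ev t n k).
Proof.
apply: measurable_funTS; elim: t n k => [c|l IHl r IHr] n k; first exact: measurable_cst.
by apply: measurable_fun_ifT => //; apply: measurable_fun_ltr; [exact: measurable_id|exact: measurable_cst].
Qed.

Lemma ev_sub t n k x : (k < 2 ^ n)%N -> dyad n k x -> ev t 0 0 x = ev (sub t n k) n k x.
Proof.
elim: n k => [|n IH] k; first by rewrite expn0 ltnS leqn0 => /eqP ->.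
move=> kn xk; rewrite (IH _ (half_lt kn) (dyad_parent xk)) /=.
case: (sub t n k./2) => //= l r.
move: xk; rewrite -{1}[k]odd_double_half; case ko: (odd k).
  by rewrite add1n => xk; have [_ /negbTE ->] := (dyad_right _ _ _).1 xk;
     rewrite -[in RHS](odd_double_half k) ko.
by rewrite add0n => xk; have [_ ->] := (dyad_left _ _ _).1 xk;
   rewrite -[in RHS](odd_double_half k) ko.
Qed.

Fixpoint nneg t : Prop := match t with Leaf c => 0 <= c | Node l r => nneg l /\ nneg r end.

Lemma pos_nneg t : pos t -> nneg t.
Proof. by elim: t => [c /ltW//|l IHl r IHr] /= [/IHl ? /IHr]. Qed.

Lemma nneg_ev t n k x : nneg t -> 0 <= ev t n k x.
Proof. by elim: t n k => //= l IHl r IHr n k [/IHl hl /IHr hr]; case: ifP. Qed.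

Lemma pos_ev t n k x : pos t -> 0 < ev t n k x.
Proof. by elim: t n k => //= l IHl r IHr n k [/IHl hl /IHr hr]; case: ifP. Qed.

Lemma nneg_child b t : nneg t -> nneg (child b t).
Proof. by case: t => // l r [] ; case: b. Qed.

Lemma nneg_sub t n k : nneg t -> nneg (sub t n k).
Proof. by move=> pt; elim: n k => //= n IH k; apply: nneg_child. Qed.

Lemma ev_tinv t n k x : ev (tinv t) n k x = (ev t n k x)^-1.
Proof. by elim: t n k => //= l IHl r IHr n k; case: ifP. Qed.

Lemma recip_ev t n k : recip (ev t n k) = ev (tinv t) n k.
Proof. by apply/funext => x; rewrite /recip ev_tinv. Qed.

Lemma integral_dyad_split n k (g : R -> \bar R) :
  measurable_fun (dyad n k) g -> (forall x, dyad n k x -> (0 <= g x)%E) ->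
  (\int[mu]_(x in dyad n k) g x = \int[mu]_(x in dyad n.+1 k.*2) g x +
     \int[mu]_(x in dyad n.+1 k.*2.+1) g x)%E.
Proof.
rewrite dyad_split => mg g0; apply: ge0_integral_setU => //;
  [exact: measurable_dyad..|exact: dyad_disj].
Qed.

Lemma integral_ev t n k : nneg t ->
  (\int[mu]_(x in dyad n k) (ev t n k x)%:E = (mean t / 2 ^+ n)%:E)%E.
Proof.
elim: t n k => [c|l IHl r IHr] n k.
  move=> c0; apply: etrans (integral_cst mu (measurable_dyad n k) c%:E) _.
  by rewrite EFinM; congr (_ * _)%E; exact: mu_dyad.
move=> [l0 r0]; have E1 : (\int[mu]_(x in dyad n.+1 k.*2) (ev (Node l r) n k x)%:E =
    (mean l / 2 ^+ n.+1)%:E)%E.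
  rewrite -(IHl _ k.*2 l0); apply: eq_integral => x; rewrite inE => /dyad_left[_ h].
  by rewrite /= h.
have E2 : (\int[mu]_(x in dyad n.+1 k.*2.+1) (ev (Node l r) n k x)%:E =
    (mean r / 2 ^+ n.+1)%:E)%E.
  rewrite -(IHr _ k.*2.+1 r0); apply: eq_integral => x; rewrite inE => /dyad_right[_ /negbTE h].
  by rewrite /= h.
rewrite integral_dyad_split.
- rewrite E1 E2 -EFinD exprS; congr EFin; rewrite /=; field.
  by rewrite gt_eqF// pow2_gt0.
- apply/measurable_EFinP; exact: (@measurable_ev (Node l r) n k).
- by move=> x _; rewrite lee_fin nneg_ev.
Qed.

Lemma integral_ev_sub t n k : nneg t -> (k < 2 ^ n)%N ->
  (\int[mu]_(x in dyad n k) (ev t 0 0 x)%:E = (mean (sub t n k) / 2 ^+ n)%:E)%E.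
Proof.
move=> t0 kn; rewrite -(integral_ev n k (nneg_sub n k t0)).
by apply: eq_integral => x; rewrite inE => xk; rewrite (ev_sub t kn xk).
Qed.

End step_functions.

(** * Averages, the A_2 constant and running maxima of step functions *)

Section averages.
Variable R : realType.
Local Notation mu := (@lebesgue_measure R).
Local Notation tree := (tree R).
Local Notation dyad := (@dyad R).
Implicit Types (t : tree) (x : R).

Lemma avg_ev t n k : nneg t -> (k < 2 ^ n)%N ->
  avg (dyad n k) (ev t 0 0) = (mean (sub t n k))%:E.
Proof.
move=> t0 kn; rewrite /avg len_dyad invrK integral_ev_sub// -EFinM; congr EFin.
by rewrite mulrC divfK// gt_eqF// pow2_gt0.
Qed.

Lemma integral_I0_ev t : nneg t -> (\int[mu]_(x in I0) (ev t 0 0 x)%:E = (mean t)%:E)%E.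
Proof. by move=> t0; rewrite I0_dyad integral_ev// expr0 divr1. Qed.

Lemma integrable_ev t : nneg t -> mu.-integrable I0 (fun x => (ev t 0 0 x)%:E).
Proof.
move=> t0; apply/integrableP; split; first by apply/measurable_EFinP; exact: measurable_ev.
have -> : (\int[mu]_(x in I0) `|(ev t 0 0 x)%:E| = \int[mu]_(x in I0) (ev t 0 0 x)%:E)%E.
  by apply: eq_integral => x _; rewrite gee0_abs// lee_fin nneg_ev.
by rewrite integral_I0_ev ?ltry.
Qed.

Lemma weight_ev t : pos t -> weight (ev t 0 0).
Proof.
move=> pt; split.
- by apply/nearW => x _; exact: pos_ev.
- exact/integrable_ev/pos_nneg.
- by rewrite recip_ev; exact/integrable_ev/pos_nneg/pos_tinv.
Qed.

Lemma A2const_le t (C : R) : pos t ->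
  allsub (fun s => mean s * mean (tinv s) <= C) t -> (A2const (ev t 0 0) <= C%:E)%E.
Proof.
move=> pt tC; apply: ge_ereal_sup => _ [_ [n [k [kn ->]]] <-].
have pit := pos_tinv pt.
rewrite recip_ev !avg_ev//; [|exact: pos_nneg..].
by rewrite -EFinM lee_fin sub_tinv; exact: (allsub_sub n k tC).
Qed.

Lemma A2const_ge t n k : pos t -> (k < 2 ^ n)%N ->
  ((mean (sub t n k) * mean (tinv (sub t n k)))%:E <= A2const (ev t 0 0))%E.
Proof.
move=> pt kn; have pit := pos_tinv pt; apply: ereal_sup_ubound.
exists (dyad n k); first by exists n, k.
by rewrite recip_ev !avg_ev ?sub_tinv//; exact: pos_nneg.
Qed.

(* The running maximum over the [d] generations below [dyad n k], started from [m]. *)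
Fixpoint mx (F : nat -> nat -> R) d n k m x : R := match d with
  | 0 => Num.max m (F n k)
  | d'.+1 => if x < mid R n k then mx F d' n.+1 k.*2 (Num.max m (F n k)) x
             else mx F d' n.+1 k.*2.+1 (Num.max m (F n k)) x end.

Lemma measurable_mx F d n k m D : measurable_fun D (mx F d n k m).
Proof.
apply: measurable_funTS; elim: d n k m => [|d IH] n k m; first exact: measurable_cst.
apply: measurable_fun_ifT => //.
by apply: measurable_fun_ltr; [exact: measurable_id|exact: measurable_cst].
Qed.

Lemma mx_ge F d n k m x : m <= mx F d n k m x.
Proof.
elim: d n k m => [|d IH] n k m /=; first by rewrite le_max lexx.
by case: ifP => _; apply: le_trans (IH _ _ _); rewrite le_max lexx.
Qed.

Lemma mx_mono F d n k m x : mx F d n k m x <= mx F d.+1 n k m x.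
Proof.
elim: d n k m => [|d IH] n k m; last by rewrite /=; case: ifP => _; exact: IH.
by rewrite /=; case: ifP => _; rewrite le_max lexx.
Qed.

Lemma mx_ge_cell F e n k m K x : dyad n k x -> dyad (n + e) K x ->
  F (n + e)%N K <= mx F e n k m x.
Proof.
elim: e n k m => [|e IH] n k m xk.
  by rewrite addn0 => xK; rewrite (dyad_inj xk xK) /= le_max lexx orbT.
rewrite -addSnnS => xK /=; case: ifP => h; apply: IH => //.
  exact/dyad_left.
by apply/dyad_right; rewrite h.
Qed.

Lemma mx_le F d n k m x (Y : \bar R) : (k < 2 ^ n)%N -> dyad n k x -> (m%:E <= Y)%E ->
  (forall n k, (k < 2 ^ n)%N -> dyad n k x -> ((F n k)%:E <= Y)%E) ->
  ((mx F d n k m x)%:E <= Y)%E.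
Proof.
move=> kn xk mY FY; have H j j' M : (M%:E <= Y)%E -> (j' < 2 ^ j)%N -> dyad j j' x ->
    ((Num.max M (F j j'))%:E <= Y)%E.
  by move=> MY jj xj; rewrite EFin_max ge_max MY FY.
elim: d n k m kn xk mY => [|d IH] n k m kn xk mY /=; first exact: H.
case: ifP => h; apply: IH; rewrite ?expnS ?mul2n ?ltn_double ?ltn_Sdouble//; try exact: H.
  exact/dyad_left.
by apply/dyad_right; rewrite h.
Qed.

Lemma integral_mx F v d n k m : pos v -> 0 <= m -> (k < 2 ^ n)%N ->
  (\int[mu]_(x in dyad n k) (mx F d n k m x ^+ 2 * ev v 0 0 x)%:E =
   (maxint F v d n k m / 2 ^+ n)%:E)%E.
Proof.
move=> pv; elim: d n k m => [|d IH] n k m m0 kn.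
  rewrite /=; under eq_integral do rewrite EFinM.
  rewrite (ge0_integralZl mu)//.
  - by rewrite integral_ev_sub//; [rewrite -EFinM mulrA|exact: pos_nneg].
  - exact: measurable_dyad.
  - by apply/measurable_EFinP; exact: measurable_ev.
  - by move=> x _; rewrite lee_fin ltW// pos_ev.
  - by rewrite lee_fin sqr_ge0.
have m'0 : 0 <= Num.max m (F n k) by rewrite le_max m0.
have E1 : (\int[mu]_(x in dyad n.+1 k.*2) (mx F d.+1 n k m x ^+ 2 * ev v 0 0 x)%:E =
    (maxint F v d n.+1 k.*2 (Num.max m (F n k)) / 2 ^+ n.+1)%:E)%E.
  rewrite -IH//; last by rewrite expnS mul2n ltn_double.
  by apply: eq_integral => x; rewrite inE => /dyad_left[_ h]; rewrite /= h.
have E2 : (\int[mu]_(x in dyad n.+1 k.*2.+1) (mx F d.+1 n k m x ^+ 2 * ev v 0 0 x)%:E =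
    (maxint F v d n.+1 k.*2.+1 (Num.max m (F n k)) / 2 ^+ n.+1)%:E)%E.
  rewrite -IH//; last by rewrite expnS mul2n ltn_Sdouble.
  by apply: eq_integral => x; rewrite inE => /dyad_right[_ /negbTE h]; rewrite /= h.
rewrite integral_dyad_split.
- rewrite E1 E2 -EFinD exprS; congr EFin; rewrite /=; field.
  by rewrite gt_eqF// pow2_gt0.
- apply/measurable_EFinP; apply: measurable_funM; last exact: measurable_ev.
  by apply: measurable_funX; exact: (@measurable_mx F d.+1 n k m).
- by move=> x _; rewrite lee_fin mulr_ge0 ?sqr_ge0// ltW// pos_ev.
Qed.

End averages.

(** * Two-sided bounds for the norm of the maximal operator *)

Section maximal.
Variable R : realType.
Local Notation mu := (@lebesgue_measure R).
Local Notation tree := (tree R).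
Local Notation dyad := (@dyad R).
Implicit Types (t : tree) (x : R).

Lemma L2normE v (g : R -> \bar R) : (forall x, I0 x -> 0 <= v x) ->
  L2norm v g = sqrte (\int[mu]_(x in I0) (g x ^+ 2 * (v x)%:E))%E.
Proof.
move=> v0; rewrite /L2norm poweR12_sqrt//; apply: integral_ge0 => x x0.
by rewrite mule_ge0 ?sqre_ge0// lee_fin v0.
Qed.

(** The maximal function may be infinite; a positive finite weight keeps its product away from
    [0 * oo]. *)
Lemma mule_def_ge0 (x y : \bar R) : (0 <= x)%E -> (0 < y)%E -> y \is a fin_num -> (x *? y)%E.
Proof.
case: x => [r||]// x0 y0 yf; first exact: mule_def_fin.
by apply: mule_def_infty_neq0; rewrite ?gt_eqF.
Qed.

Section maximal_operator.
Variables (t : tree) (f : R -> R).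
Hypotheses (pt : pos t) (mf : measurable_fun I0 f).
Local Notation s := (ev t 0 0).
Local Notation v := (ev (tinv t) 0 0).
Hypothesis fin : (\int[mu]_(x in I0) (f x ^+ 2 * v x)%:E < +oo)%E.

Let pit := pos_tinv pt.
Let A n k := (\int[mu]_(x in dyad n k) `|f x|%:E)%E.
Let B n k := (\int[mu]_(x in dyad n k) (f x ^+ 2 * v x)%:E)%E.
Let F n k := fine (avg (dyad n k) (fun x => `|f x|)).
Let q n k := fine (B n k) * 2 ^+ n.

Let mabs n k : (k < 2 ^ n)%N -> measurable_fun (dyad n k) (fun x => `|f x|%:E).
Proof.
move=> kn; apply/measurable_EFinP; apply: measurableT_comp => //.
by apply: measurable_funS mf; [rewrite I0_dyad; exact: measurable_dyad|exact: dyad_sub].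
Qed.

Let msqr n k : (k < 2 ^ n)%N -> measurable_fun (dyad n k) (fun x => (f x ^+ 2 * v x)%:E).
Proof.
move=> kn; apply/measurable_EFinP; apply: measurable_funM; last exact: measurable_ev.
apply: measurable_funX.
by apply: measurable_funS mf; [rewrite I0_dyad; exact: measurable_dyad|exact: dyad_sub].
Qed.

Let sqr_ge0' x : (0 <= (f x ^+ 2 * v x)%:E)%E.
Proof. by rewrite lee_fin mulr_ge0 ?sqr_ge0// ltW// pos_ev. Qed.

Let A0 n k : (0 <= A n k)%E. Proof. by apply: integral_ge0 => x _; rewrite lee_fin. Qed.

Let B0 n k : (0 <= B n k)%E. Proof. by apply: integral_ge0. Qed.

Let Bfin n k : (k < 2 ^ n)%N -> B n k \is a fin_num.
Proof.
move=> kn; rewrite ge0_fin_numE//; apply: le_lt_trans fin.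
apply: ge0_subset_integral => //; [exact: measurable_dyad|
  by rewrite I0_dyad; exact: measurable_dyad| |exact: dyad_sub].
by rewrite I0_dyad; exact: msqr.
Qed.

(* Integrated form of [2 l |f| <= f^2 v + l^2 s], where [v s = 1]. *)
Let amgm n k l : (k < 2 ^ n)%N -> 0 <= l ->
  ((2 * l)%:E * A n k <= B n k + (l ^+ 2 * (mean (sub t n k) / 2 ^+ n))%:E)%E.
Proof.
move=> kn l0; have mD := @measurable_dyad R n k.
have l20 : 0 <= 2 * l by rewrite mulr_ge0.
rewrite -(ge0_integralZl mu mD (mabs kn))//.
rewrite (EFinM (l ^+ 2)) -(integral_ev_sub (pos_nneg pt) kn).
have s0 x : (0 <= (s x)%:E)%E by rewrite lee_fin ltW// pos_ev.
have ms : measurable_fun (dyad n k) (fun x => (s x)%:E).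
  by apply/measurable_EFinP; exact: measurable_ev.
rewrite -(ge0_integralZl mu mD ms)//; last by rewrite lee_fin sqr_ge0.
have ls0 x : (0 <= (l ^+ 2)%:E * (s x)%:E)%E by rewrite mule_ge0// lee_fin sqr_ge0.
rewrite -(ge0_integralD mu mD)//; [|exact: msqr|exact: measurable_funeM].
apply: ge0_le_integral => //.
- by move=> x _; rewrite -EFinM lee_fin mulr_ge0.
- by apply: measurable_funeM; exact: mabs.
- by apply: emeasurable_funD; [exact: msqr|exact: measurable_funeM].
- move=> x _; rewrite -!EFinM -EFinD lee_fin ev_tinv -subr_ge0.
  have s0' : 0 < s x by rewrite pos_ev.
  have -> : f x ^+ 2 / s x + l ^+ 2 * s x - 2 * l * `|f x| = (`|f x| - l * s x) ^+ 2 / s x.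
    by rewrite -(real_normK (num_real (f x))); field; rewrite gt_eqF.
  by rewrite divr_ge0 ?sqr_ge0// ltW.
Qed.

(** [amgm] at [l = 1] bounds the integral of [|f|] by finite quantities. *)
Let Afin n k : (k < 2 ^ n)%N -> A n k \is a fin_num.
Proof.
move=> kn; rewrite ge0_fin_numE//.
have := amgm kn ler01; rewrite -(fineK (Bfin kn)) -EFinD => /le_lt_trans/(_ (ltry _)).
case: (A n k) (A0 n k) => [r||] // _; first by move=> _; rewrite ltry.
by rewrite gt0_muley// lte_fin mulr1.
Qed.

Let FE n k : (k < 2 ^ n)%N -> F n k = fine (A n k) * 2 ^+ n.
Proof.
move=> kn; rewrite /F /avg len_dyad invrK -/(A n k) -(fineK (Afin kn)) -EFinM /=.
by rewrite mulrC.
Qed.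

Let avgF n k : (k < 2 ^ n)%N -> avg (dyad n k) (fun x => `|f x|) = (F n k)%:E.
Proof.
by move=> kn; rewrite FE// /avg len_dyad invrK -/(A n k) -{1}(fineK (Afin kn)) -EFinM mulrC.
Qed.

Let F0 n k : 0 <= F n k.
Proof.
apply: fine_ge0; apply: mule_ge0; last exact: A0.
by rewrite lee_fin len_dyad invrK ltW// pow2_gt0.
Qed.

Let ltd n k : (k < 2 ^ n)%N -> (k.*2 < 2 ^ n.+1)%N.
Proof. by rewrite expnS mul2n ltn_double. Qed.

Let ltdS n k : (k < 2 ^ n)%N -> (k.*2.+1 < 2 ^ n.+1)%N.
Proof. by rewrite expnS mul2n ltn_Sdouble. Qed.

Let Fmart n k : (k < 2 ^ n)%N -> F n k = (F n.+1 k.*2 + F n.+1 k.*2.+1) / 2.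
Proof.
move=> kn; have kl := ltd kn; have kr := ltdS kn.
rewrite !FE// {1}/A integral_dyad_split; [|exact: mabs|by []].
by rewrite fineD ?Afin// exprS; field.
Qed.

Let qmart n k : (k < 2 ^ n)%N -> q n k = (q n.+1 k.*2 + q n.+1 k.*2.+1) / 2.
Proof.
move=> kn; have kl := ltd kn; have kr := ltdS kn.
rewrite /q {1}/B integral_dyad_split; [|exact: msqr|by []].
by rewrite fineD ?Bfin// exprS; field.
Qed.

Let Fq n k : (k < 2 ^ n)%N -> F n k ^+ 2 <= q n k * mean (sub t n k).
Proof.
move=> kn; have S0 := pos_mean (pos_sub n k pt); have P0 := pow2_gt0 R n.
(* The minimizing choice of [l], turning [amgm] into the Cauchy-Schwarz inequality. *)
pose l := F n k / mean (sub t n k).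
have l0 : 0 <= l by rewrite divr_ge0// ltW.
have := amgm kn l0; rewrite -(fineK (Afin kn)) -(fineK (Bfin kn)) -EFinM -EFinD lee_fin.
have -> : fine (A n k) = F n k / 2 ^+ n by rewrite FE// mulfK// gt_eqF.
rewrite -(ler_pM2r P0) -(ler_pM2r S0).
have -> : 2 * l * (F n k / 2 ^+ n) * 2 ^+ n * mean (sub t n k) = 2 * F n k ^+ 2.
  by rewrite /l; field; rewrite !gt_eqF.
have -> : (fine (B n k) + l ^+ 2 * (mean (sub t n k) / 2 ^+ n)) * 2 ^+ n *
    mean (sub t n k) = q n k * mean (sub t n k) + F n k ^+ 2.
  by rewrite /l /q; field; rewrite !gt_eqF.
by lra.
Qed.

Let dyadic0 : (0 < 2 ^ 0)%N. Proof. by []. Qed.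

Let mxx d x := mx F d 0 0 0 x.

Let mxx_homo x : {homo mxx ^~ x : d d' / (d <= d')%N >-> d <= d'}.
Proof. by apply: homo_leq => [//|d d' d'' | d]; [exact: le_trans|exact: mx_mono]. Qed.

Let mxx_ge0 d x : 0 <= mxx d x. Proof. exact: mx_ge. Qed.

(** The running maximum of depth [n] meets the cell of generation [n] containing [x]; the starting
    value 0 is harmless since averages of [|f|] are nonnegative. *)
Lemma maximal_eq x : I0 x -> maximal f x = ereal_sup (range (fun d => (mxx d x)%:E)).
Proof.
move=> x0; apply/eqP; rewrite eq_le; apply/andP; split.
  apply: ge_ereal_sup => _ [_ [[n [k [kn ->]]] xk] <-].
  rewrite avgF//; apply: (@le_trans _ _ (mxx n x)%:E).
    by rewrite lee_fin -(add0n n); apply: mx_ge_cell => //; rewrite -I0_dyad.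
  by apply: ereal_sup_ubound; exists n.
apply: ge_ereal_sup => _ [d _ <-].
have H n k : (k < 2 ^ n)%N -> dyad n k x -> ((F n k)%:E <= maximal f x)%E.
  move=> kn xk; rewrite -avgF//; apply: ereal_sup_ubound.
  by exists (dyad n k) => //; split=> //; exists n, k.
apply: mx_le => //; first by rewrite -I0_dyad.
apply: (le_trans _ (H 0 0 dyadic0 _)); first by rewrite lee_fin.
by rewrite -I0_dyad.
Qed.

Lemma maximal_cvg x : I0 x ->
  (mxx d x ^+ 2 * v x)%:E @[d --> \oo] --> (maximal f x ^+ 2 * (v x)%:E)%E.
Proof.
move=> x0; have := @ereal_nondecreasing_cvgn R (fun d => (mxx d x)%:E) _.
rewrite -maximal_eq// => H.
have {}H : (mxx d x)%:E @[d --> \oo] --> maximal f x.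
  by apply: H => d d' dd; rewrite lee_fin; exact: mxx_homo.
have M0 : (0 <= maximal f x)%E.
  by rewrite maximal_eq//; apply: le_trans (ereal_sup_ubound _); [|by exists 0%N]; rewrite lee_fin.
have vx0 : (0 < (v x)%:E)%E by rewrite lte_fin pos_ev.
under eq_fun do rewrite EFinM EFin_expe expe2.
apply: cvgeM; last exact: cvg_cst.
  exact: mule_def_ge0 (sqre_ge0 _) vx0 _.
rewrite expe2; apply: cvgeM => //.
by case: (maximal f x) M0 => [r||].
Qed.

(** Monotone convergence reduces the claim to finite depth, where [maxint_le] is uniform in [d]. *)
Lemma maximal_L2 (T : R) : 0 < T -> allsub (fun u => test u 0 <= T * mean u) t ->
  (\int[mu]_(x in I0) (maximal f x ^+ 2 * (v x)%:E) <=
   (4 * T)%:E * \int[mu]_(x in I0) (f x ^+ 2 * v x)%:E)%E.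
Proof.
move=> T0 tT; have mD : measurable (I0 : set R) by rewrite I0_dyad; exact: measurable_dyad.
have -> : (\int[mu]_(x in I0) (maximal f x ^+ 2 * (v x)%:E) =
    \int[mu]_(x in I0) limn (fun d => (mxx d x ^+ 2 * v x)%:E))%E.
  by apply: eq_integral => x; rewrite inE => x0; apply/esym/cvg_lim => //; exact: maximal_cvg.
pose g d x := (mxx d x ^+ 2 * v x)%:E.
have mg d : measurable_fun I0 (g d).
  apply/measurable_EFinP; apply: measurable_funM; last exact: measurable_ev.
  by apply: measurable_funX; exact: measurable_mx.
have g0 d x : I0 x -> (0 <= g d x)%E.
  by move=> _; rewrite lee_fin mulr_ge0 ?sqr_ge0// ltW// pos_ev.
have gS x : I0 x -> {homo g^~ x : d d' / (d <= d')%N >-> (d <= d')%E}.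
  move=> _ d d' dd; rewrite lee_fin ler_pM2r ?pos_ev//.
  by apply: lerXn2r; rewrite ?nnegrE//; exact: mxx_homo.
rewrite (monotone_convergence mu mD mg g0 gS).
have := cvgP _ (cvg_monotone_convergence (mu := mu) mD mg g0 gS).
have -> : (fun d => \int[mu]_(x in I0) g d x)%E =
    fun d => (maxint F (tinv t) d 0 0 0)%:E.
  by apply/funext => d; rewrite I0_dyad (integral_mx F d pit)// expr0 divr1.
have B00 : (\int[mu]_(x in I0) (f x ^+ 2 * v x)%:E)%E = (q 0 0)%:E.
  by rewrite /q expr0 mulr1 fineK ?Bfin// /B I0_dyad.
rewrite B00 -EFinM => cvg_max; apply: lime_le => //.
apply: nearW => d; rewrite lee_fin.
exact: maxint_le T0 pt tT Fmart qmart Fq d.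
Qed.

Lemma measurable_maximal : measurable_fun I0 (fun x => maximal f x ^+ 2 * (v x)%:E)%E.
Proof.
apply: (@emeasurable_fun_cvg _ _ _ _ (fun d x => (mxx d x ^+ 2 * v x)%:E)).
  move=> d; apply/measurable_EFinP; apply: measurable_funM; last exact: measurable_ev.
  by apply: measurable_funX; exact: measurable_mx.
exact: maximal_cvg.
Qed.

End maximal_operator.

Lemma measurable_I0 : measurable (I0 : set R).
Proof. by rewrite I0_dyad; exact: measurable_dyad. Qed.

Lemma sqrte_lty (x : \bar R) : (sqrte x < +oo -> x < +oo)%E.
Proof. by case: x => [r||]//=; rewrite ?ltry ?ltNyr. Qed.

Lemma L2norm_EFin v (g : R -> R) : (forall x, I0 x -> 0 <= v x) ->
  L2norm v (EFin \o g) = sqrte (\int[mu]_(x in I0) (g x ^+ 2 * v x)%:E)%E.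
Proof.
move=> v0; rewrite L2normE//; congr (sqrte _); apply: eq_integral => x _.
Qed.

Lemma maximal_norm_le t (T : R) : pos t -> 0 < T ->
  allsub (fun u => test u 0 <= T * mean u) t ->
  (maximal_norm (ev (tinv t) 0 0) <= (Num.sqrt (4 * T))%:E)%E.
Proof.
move=> pt T0 tT; apply: ereal_inf_lbound; exists (Num.sqrt (4 * T)) => //.
split=> [|f mf]; first exact: sqrtr_ge0.
have v0 x : I0 x -> 0 <= ev (tinv t) 0 0 x by move=> _; exact/ltW/pos_ev/pos_tinv.
rewrite L2norm_EFin// L2normE// => /sqrte_lty fin.
have T40 : (0 <= (4 * T)%:E)%E by rewrite lee_fin mulr_ge0// ltW.
rewrite -[(Num.sqrt _)%:E]/(sqrte (4 * T)%:E) -sqrteM// lee_sqrt; first exact: maximal_L2.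
apply: mule_ge0 => //; apply: integral_ge0 => x x0.
by rewrite lee_fin mulr_ge0 ?sqr_ge0 ?v0.
Qed.

Lemma opnorm_ge (NX NY : (R -> \bar R) -> \bar R) (T : (R -> R) -> R -> \bar R)
    (f : R -> R) (a b : R) : measurable_fun I0 f -> 0 < a ->
  NX (EFin \o f) = a%:E -> (b%:E <= NY (T f))%E -> ((b / a)%:E <= opnorm NX NY T)%E.
Proof.
move=> mf a0 fa Tb; apply: le_ereal_inf_tmp => _ [C [C0 HC] <-].
rewrite lee_fin ler_pdivrMr// -lee_fin EFinM -fa; apply: le_trans Tb (HC _ mf _).
by rewrite fa ltry.
Qed.

Lemma integral_I0_indic (A : set R) (g : R -> R) : measurable A -> A `<=` I0 ->
  (\int[mu]_(x in I0) (\1_A x * g x)%:E = \int[mu]_(x in A) (g x)%:E)%E.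
Proof.
move=> mA AI; rewrite -{2}(setIidr AI) integral_mkcondr; apply: eq_integral => x _.
by rewrite patchE indicE; case: (x \in A); rewrite ?mul1r ?mul0r.
Qed.

(** Test on [s 1_J]: its squared norm is the integral of [s] over [J], while its maximal function is
    at least the mean of [s] throughout [J]. *)
Lemma maximal_norm_ge t n k : pos t -> (k < 2 ^ n)%N ->
  ((Num.sqrt (mean (sub t n k) * mean (tinv (sub t n k))))%:E <=
   maximal_norm (ev (tinv t) 0 0))%E.
Proof.
move=> pt kn; set S := mean (sub t n k); set V := mean (tinv _).
have S0 : 0 < S := pos_mean (pos_sub n k pt).
have V0 : 0 < V := pos_mean (pos_tinv (pos_sub n k pt)).
have P0 := pow2_gt0 R n; have pit := pos_tinv pt.
pose f x := \1_(dyad n k) x * ev t 0 0 x.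
have mJ := @measurable_dyad R n k; have JI := @dyad_sub R n k kn.
have mf : measurable_fun I0 f.
  by apply: measurable_funM; [exact: measurable_indic|exact: measurable_ev].
have v0 x : I0 x -> 0 <= ev (tinv t) 0 0 x by move=> _; exact/ltW/pos_ev.
have fE : (\int[mu]_(x in I0) (f x ^+ 2 * ev (tinv t) 0 0 x)%:E)%E = (S / 2 ^+ n)%:E.
  rewrite -(integral_ev_sub (pos_nneg pt) kn) -(integral_I0_indic _ mJ JI).
  have E x : f x ^+ 2 * ev (tinv t) 0 0 x = \1_(dyad n k) x * ev t 0 0 x.
    rewrite /f ev_tinv indicE; have p := pos_ev 0 0 x pt.
    by case: (x \in dyad n k) => /=; field; rewrite gt_eqF.
  by apply: eq_integral => x _; rewrite E.
have fin : (\int[mu]_(x in I0) (f x ^+ 2 * ev (tinv t) 0 0 x)%:E < +oo)%E.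
  by rewrite fE ltry.
have -> : Num.sqrt (S * V) = Num.sqrt (S ^+ 2 * V / 2 ^+ n) / Num.sqrt (S / 2 ^+ n).
  have h : 0 < S / 2 ^+ n by rewrite divr_gt0.
  have -> : S ^+ 2 * V / 2 ^+ n = S * V * (S / 2 ^+ n) by field; rewrite gt_eqF.
  rewrite [in RHS]sqrtrM; last by rewrite mulr_ge0 // ltW.
  by rewrite mulfK// gt_eqF// sqrtr_gt0.
apply: (opnorm_ge mf).
- by rewrite sqrtr_gt0 divr_gt0.
- by rewrite L2norm_EFin// fE.
rewrite L2normE// -[(Num.sqrt _)%:E]/(sqrte (_)%:E) lee_sqrt; last first.
  by apply: integral_ge0 => x x0; rewrite mule_ge0 ?sqre_ge0 ?lee_fin ?v0.
have -> : (S ^+ 2 * V / 2 ^+ n)%:E =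
    (\int[mu]_(x in I0) (\1_(dyad n k) x * (S ^+ 2 * ev (tinv t) 0 0 x))%:E)%E.
  rewrite integral_I0_indic//; under eq_integral do rewrite EFinM.
  rewrite (ge0_integralZl mu mJ)//.
  - by rewrite integral_ev_sub// ?sub_tinv -?EFinM ?mulrA//; exact: pos_nneg.
  - by apply/measurable_EFinP; exact: measurable_ev.
  - by move=> x _; rewrite lee_fin ltW// pos_ev.
  - by rewrite lee_fin sqr_ge0.
apply: ge0_le_integral => //.
- exact: measurable_I0.
- move=> x x0; rewrite lee_fin; apply: mulr_ge0; first by rewrite indicE.
  by apply: mulr_ge0; [exact: sqr_ge0|exact: v0].
- apply/measurable_EFinP; apply: measurable_funM; first exact: measurable_indic.
  by apply: measurable_funM; [exact: measurable_cst|exact: measurable_ev].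
- exact: measurable_maximal.
- move=> x x0; rewrite indicE; case: (boolP (x \in dyad n k)) => [|_]; last first.
    by rewrite mul0r mule_ge0 ?sqre_ge0 ?lee_fin ?v0.
  rewrite inE mul1r EFinM EFin_expe => xJ; apply: lee_wpmul2r; first by rewrite lee_fin v0.
  have SM : (S%:E <= maximal f x)%E.
    have -> : S%:E = avg (dyad n k) (fun y => `|f y|).
      rewrite -(avg_ev (pos_nneg pt) kn) /avg; congr (_ * _)%E; apply: eq_integral => y.
      by rewrite /f indicE => ->; rewrite mul1r gtr0_norm// pos_ev.
    by apply: ereal_sup_ubound; exists (dyad n k) => //; split => //; exists n, k.
  have S0' : (0 <= S%:E)%E by rewrite lee_fin ltW.
  by rewrite lee_sqr// (le_trans S0' SM).
Qed.

End maximal.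

(** * The square function of a step function *)

Section square_function.
Variable R : realType.
Local Notation mu := (@lebesgue_measure R).
Local Notation tree := (tree R).
Local Notation dyad := (@dyad R).
Implicit Types (a b t : tree) (x : R).

Definition level_sum (phi : tree -> tree -> R) m a b : R :=
  \sum_(k < 2 ^ m) phi (sub a m k) (sub b m k).

(** [sub] peels off the lowest binary digit of [k], while [gain] descends from the root. This lemma
    and the next read the highest digit first. *)
Lemma sub_low t m k : (k < 2 ^ m)%N -> sub t m.+1 k = sub (child false t) m k.
Proof.
elim: m k => [|m IH] k; first by rewrite expn0 ltnS leqn0 => /eqP ->.
by move=> km; rewrite [LHS]/= -/(sub t m.+1 k./2) IH ?half_lt.
Qed.

Lemma sub_high t m k : (k < 2 ^ m)%N -> sub t m.+1 (2 ^ m + k) = sub (child true t) m k.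
Proof.
elim: m k => [|m IH] k; first by rewrite expn0 ltnS leqn0 => /eqP ->.
move=> km; rewrite [LHS]/= -/(sub t m.+1 _./2).
by rewrite expnS mul2n halfD oddD odd_double doubleK !add0n IH ?half_lt.
Qed.

Lemma level_sumS phi m a b : level_sum phi m.+1 a b =
  level_sum phi m (child false a) (child false b) + level_sum phi m (child true a) (child true b).
Proof.
rewrite /level_sum expnS mul2n -addnn big_split_ord /=; congr (_ + _); apply: eq_bigr => k _.
  by have /= -> := sub_low a (ltn_ord k); have /= -> := sub_low b (ltn_ord k).
by have /= -> := sub_high a (ltn_ord k); have /= -> := sub_high b (ltn_ord k).
Qed.

Lemma gain_level_sum d a b : gain d a b = \sum_(n < d) level_sum
  (fun s u => ((mean (child true s) - mean (child false s)) / 2) ^+ 2 * mean u) n a b / 2 ^+ n.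
Proof.
elim: d a b => [|d IH] a b; first by rewrite big_ord0.
rewrite big_ord_recl /= expr0 divr1 {1}/level_sum expn0 big_ord1 /=; congr (_ + _).
rewrite !IH -big_split /= mulr_suml; apply: eq_bigr => n _.
rewrite /bump /= add1n level_sumS exprS.
by field; rewrite gt_eqF// pow2_gt0.
Qed.

Lemma integrable_indic_ev (A : set R) a : nneg a -> measurable A -> A `<=` I0 ->
  mu.-integrable I0 (fun x => (\1_A x * ev a 0 0 x)%:E).
Proof.
move=> a0 mA AI; apply: (le_integrable _ _ _ (integrable_ev a0)).
- exact: measurable_I0.
- apply/measurable_EFinP; apply: measurable_funM; first exact: measurable_indic.
  exact: measurable_ev.
- move=> x _; rewrite !gee0_abs ?lee_fin ?mulr_ge0 ?nneg_ev ?indicE//.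
  by rewrite ler_piMl ?nneg_ev// lern1 leq_b1.
Qed.

Lemma haar_coef_ev a n k : nneg a -> (k < 2 ^ n)%N ->
  haar_coef (ev a 0 0) n k = ((Num.sqrt (2 ^- n : R))^-1 *
    ((mean (child true (sub a n k)) - mean (child false (sub a n k))) / 2 ^+ n.+1))%:E.
Proof.
move=> a0 kn; set c := (Num.sqrt _)^-1.
have kl : (k.*2 < 2 ^ n.+1)%N by rewrite expnS mul2n ltn_double.
have kr : (k.*2.+1 < 2 ^ n.+1)%N by rewrite expnS mul2n ltn_Sdouble.
have mL := @measurable_dyad R n.+1 k.*2; have mR := @measurable_dyad R n.+1 k.*2.+1.
have LI := dyad_sub (R := R) kl; have RI := dyad_sub (R := R) kr.
have iL := integrable_indic_ev a0 mL LI; have iR := integrable_indic_ev a0 mR RI.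
have mI := @measurable_I0 R.
have -> : haar_coef (ev a 0 0) n k = (\int[mu]_(x in I0) (c%:E *
    ((\1_(dyad n.+1 k.*2.+1) x * ev a 0 0 x)%:E - (\1_(dyad n.+1 k.*2) x * ev a 0 0 x)%:E)))%E.
  apply: eq_integral => x _; rewrite -EFinB -EFinM /haar len_dyad; congr EFin.
  by rewrite /c; ring.
rewrite integralZl//; last exact: integrableB.
rewrite integralB_EFin// !integral_I0_indic// !integral_ev_sub//.
by rewrite -EFinB -EFinM sub_double sub_doubleS -mulrBl.
Qed.

Lemma square_fun_sqr f x : (square_fun f x ^+ 2 =
  \sum_(0 <= n <oo) \sum_(k < 2 ^ n)
      haar_coef f n k ^+ 2 * (\1_(dyad n k) x / len (dyad n k))%:E)%E.
Proof.
have h : (0 <= \sum_(0 <= n <oo) \sum_(k < 2 ^ n)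
    haar_coef f n k ^+ 2 * (\1_(dyad n k) x / len (dyad n k))%:E)%E.
  apply: nneseries_ge0 => n _ _; apply: sume_ge0 => k _.
  by rewrite mule_ge0 ?sqre_ge0// lee_fin len_dyad divr_ge0 ?indicE// invr_ge0 ltW// pow2_gt0.
by rewrite /square_fun poweR12_sqrt// sqr_sqrte.
Qed.

(** Generations from [d] on are discarded. In the others [(a, h_I)^2 / |I|] is the square of half
    the difference of the two child means, which is the summand of [gain]. *)
Lemma square_fun_L2_ge a b d : nneg a -> pos b ->
  ((gain d a b)%:E <= \int[mu]_(x in I0) (square_fun (ev a 0 0) x ^+ 2 * (ev b 0 0 x)%:E))%E.
Proof.
move=> a0 pb; have mI := @measurable_I0 R.
have term0 n (k : 'I_(2 ^ n)) x :
    (0 <= haar_coef (ev a 0 0) n k ^+ 2 * (\1_(dyad n k) x / len (dyad n k))%:E)%E.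
  by rewrite mule_ge0 ?sqre_ge0// lee_fin len_dyad divr_ge0 ?indicE// invr_ge0 ltW// pow2_gt0.
have b0 x : (0 <= (ev b 0 0 x)%:E)%E by rewrite lee_fin ltW// pos_ev.
have mb : measurable_fun I0 (fun x => (ev b 0 0 x)%:E).
  by apply/measurable_EFinP; exact: measurable_ev.
have mterm n (k : 'I_(2 ^ n)) : measurable_fun I0 (fun x => 
    haar_coef (ev a 0 0) n k ^+ 2 * (\1_(dyad n k) x / len (dyad n k))%:E)%E.
  apply: measurable_funeM; apply/measurable_EFinP; apply: measurable_funM => //.
  by apply: measurable_indic; exact: measurable_dyad.
pose c (n k : nat) := (mean (child true (sub a n k)) - mean (child false (sub a n k))) / 2.
have ib0 n k x : (0 <= (c n k ^+ 2)%:E * (\1_(dyad n k) x * ev b 0 0 x)%:E)%E.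
  by rewrite -EFinM lee_fin mulr_ge0 ?sqr_ge0// mulr_ge0 ?indicE// ltW// pos_ev.
have mib n k : measurable_fun I0 (fun x => (\1_(dyad n k) x * ev b 0 0 x)%:E).
  apply/measurable_EFinP; apply: measurable_funM; last exact: measurable_ev.
  by apply: measurable_indic; exact: measurable_dyad.
have -> : (gain d a b)%:E = (\int[mu]_(x in I0) (\sum_(n < d) \sum_(k < 2 ^ n)
    (c n k ^+ 2)%:E * (\1_(dyad n k) x * ev b 0 0 x)%:E))%E.
  rewrite (ge0_integral_sum mu mI); last 2 first.
  - by move=> n; apply: emeasurable_sum => k; apply: measurable_funeM; exact: mib.
  - by move=> n x _; apply: sume_ge0 => k _.
  rewrite gain_level_sum -sumEFin; apply: eq_bigr => n _.
  rewrite (ge0_integral_sum mu mI); last 2 first.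
  - by move=> k; apply: measurable_funeM; exact: mib.
  - by move=> k x _.
  rewrite /level_sum mulr_suml -sumEFin; apply: eq_bigr => k _.
  have kn := ltn_ord k.
  rewrite (ge0_integralZl mu mI (mib n k)); last 2 first.
  - by move=> x _; rewrite lee_fin mulr_ge0 ?indicE// ltW// pos_ev.
  - by rewrite lee_fin sqr_ge0.
  rewrite integral_I0_indic; [|exact: measurable_dyad|exact: dyad_sub].
  by rewrite integral_ev_sub//; [rewrite -EFinM mulrA|exact: pos_nneg].
apply: ge0_le_integral => //.
- by move=> x _; apply: sume_ge0 => n _; apply: sume_ge0.
- apply: emeasurable_sum => n; apply: emeasurable_sum => k.
  by apply: measurable_funeM; exact: mib.
- under eq_fun do rewrite square_fun_sqr; apply: emeasurable_funM => //.
  apply: ge0_emeasurable_sum => [n x _ _|n _]; first by apply: sume_ge0.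
  by apply: emeasurable_sum => k; exact: mterm.
- move=> x _; rewrite square_fun_sqr.
  apply: le_trans (lee_wpmul2r (b0 x) (nneseries_lim_ge d _)); last first.
    by move=> n _ _; apply: sume_ge0.
  rewrite big_mkord ge0_sume_distrl; last by move=> n _; apply: sume_ge0.
  apply: lee_sum => n _; rewrite ge0_sume_distrl//; apply: lee_sum => k _.
  rewrite haar_coef_ev// len_dyad -EFin_expe -!EFinM lee_fin le_eqVlt; apply/orP; left.
  have -> : Num.sqrt (2 ^- n : R) = Num.sqrt (2 ^+ n)^-1 by [].
  have sq : (Num.sqrt (2 ^+ n)^-1)^-1 ^+ 2 = 2 ^+ n :> R.
    by rewrite exprVn sqr_sqrtr ?invrK// invr_ge0 ltW// pow2_gt0.
  apply/eqP; rewrite /c [in RHS]exprMn sq invrK (exprS _ n).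
  by field; rewrite gt_eqF// pow2_gt0.
Qed.

End square_function.

(** * Norm bounds for the weight and its inverse placed side by side *)

Section weights.
Variable R : realType.
Local Notation mu := (@lebesgue_measure R).
Local Notation tree := (tree R).
Local Notation dyad := (@dyad R).
Implicit Types (a b t : tree) (x : R).

(** [m <= (4^L)^3] and [ln 4 <= 3] give [ln m <= 9 L]. With [m^2 <= 172 K] the constant works
    because [172 * 9 / 129^2 = 4 / 43 <= 3 / 32]. *)
Lemma norm_bound (L : nat) (m K : R) : (0 < L)%N -> K = (4 ^+ L) ^+ 2 ->
  Num.sqrt (K / 2) <= m <= Num.sqrt (172 * K) ->
  ((1 / 129)%:E * m%:E * (lne m%:E `^ 2^-1) <= (Num.sqrt (3 / 32 * L%:R * K))%:E)%E.
Proof.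
move=> L0 KE /andP[m1 m2].
have N4 : 4 <= 4 ^+ L :> R.
  by rewrite -[leLHS]expr1; apply: ler_weXn2l => //; lra.
have K16 : 16 <= K by rewrite KE; move: (4 ^+ L) N4 => z; nra.
have m0 : 1 <= m.
  by apply: le_trans m1; rewrite -[leLHS]sqrtr1 ler_sqrt; lra.
have mK : m ^+ 2 <= 172 * K.
  have -> : 172 * K = Num.sqrt (172 * K) ^+ 2 by rewrite sqr_sqrtr//; lra.
  by apply: lerXn2r; rewrite ?nnegrE ?sqrtr_ge0//; lra.
have ln0 : 0 <= ln m by exact: ln_ge0.
have lnm : ln m <= 9 * L%:R.
  have mN : m <= 4 ^+ (3 * L).
    rewrite -(@ler_pXn2r _ 2) ?nnegrE ?exprn_ge0//; last lra.
    apply: le_trans mK _; rewrite KE mulnC !exprM; move: (4 ^+ L) N4 => z z4.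
    have z2 : 16 <= z ^+ 2 by nra.
    have z4' : 256 <= (z ^+ 2) ^+ 2 by nra.
    have -> : (z ^+ 3) ^+ 2 = (z ^+ 2) ^+ 2 * z ^+ 2 by ring.
    by rewrite ler_pM2r; lra.
  have ln4 : ln 4 <= 3 :> R.
    have -> : 4 = 1 + 3 :> R by ring.
    by apply: le_ln1Dx; lra.
  apply: (@le_trans _ _ (ln (4 ^+ (3 * L)))).
    by rewrite ler_ln ?posrE ?exprn_gt0//; lra.
  rewrite lnXn// -[ln 4 *+ _]mulr_natr natrM.
  by have := ler_wpM2r (ler0n R L) ln4; move: (ln 4) (L%:R : R) => y z; lra.
rewrite lne_EFin; last lra.
rewrite poweR12_sqrt ?lee_fin//.
have -> : 1 / 129 * m * Num.sqrt (ln m) = Num.sqrt ((1 / 129 * m) ^+ 2 * ln m).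
  rewrite sqrtrM ?sqr_ge0// sqrtr_sqr ger0_norm//; lra.
rewrite ler_sqrt; last by rewrite mulr_ge0 ?mulr_ge0//; lra.
have h : m ^+ 2 * ln m <= 172 * K * (9 * L%:R) by apply: ler_pM => //; exact: sqr_ge0.
have : 0 <= K * L%:R by rewrite mulr_ge0//; lra.
rewrite exprMn; lra.
Qed.

(** The distribution function of an indicator is constant on (0, 1), so its Lorentz norm equals its
    weighted L2 norm; one test function thus serves both estimates. *)
Lemma L21norm_left (w : R -> R) (c : R) : 0 <= c ->
  (\int[mu]_(x in dyad 1 0) (w x)%:E = (c ^+ 2)%:E)%E ->
  L21norm w (EFin \o ev (Node (Leaf 1) (Leaf 0)) 0 0) = c%:E.
Proof.
move=> c0 wc; rewrite /L21norm.
have -> : (\int[mu]_(t in `]0%R, +oo[)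
    (wmeas w [set x | t%:E < `|(EFin \o ev (Node (Leaf 1) (Leaf 0)) 0 0) x|] `^ 2^-1) =
    \int[mu]_(t in `]0%R, +oo[) (c%:E * (\1_`]0%R, 1%R[ t)%:E))%E.
  apply: eq_integral => t; rewrite inE /= in_itv /= andbT => t0.
  rewrite indicE; have [t1|t1] := ltP t 1.
    have -> : (t \in `]0%R, 1%R[%classic) = true by apply/mem_set; rewrite /= in_itv /= t0.
    rewrite mule1 /wmeas.
    have -> : I0 `&` [set x | (t%:E < `|(EFin \o ev (Node (Leaf 1) (Leaf 0)) 0 0) x|)%E] = dyad 1 0.
      apply/seteqP; split => x /=.
        rewrite I0_dyad => -[x0]; case: ifP => h.
          by move=> _; apply/(dyad_left 0 0 x).
        by rewrite normr0 lte_fin ltNge ltW.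
      move=> /(dyad_left 0 0 x)[x0 ->]; split; first by rewrite I0_dyad.
      by rewrite normr1 lte_fin.
    by rewrite wc poweR12_sqrt ?lee_fin ?sqr_ge0//= sqrtr_sqr ger0_norm.
  have -> : (t \in `]0%R, 1%R[%classic) = false.
    by apply/memNset; rewrite /= in_itv /= => /andP[_]; rewrite ltNge t1.
  rewrite mule0 /wmeas.
  have -> : I0 `&` [set x | (t%:E < `|(EFin \o ev (Node (Leaf 1) (Leaf 0)) 0 0) x|)%E] = set0.
    apply/seteqP; split => x //= -[_]; case: ifP => _; rewrite lte_fin.
      by rewrite normr1 ltNge t1.
    by rewrite normr0 ltNge ltW.
  by rewrite integral_set0 poweR0r// invr_eq0.
rewrite ge0_integralZl//.
- rewrite integral_indic// setIidl.
    rewrite -[RHS]mule1; congr (_ * _)%E.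
    apply: etrans (lebesgue_measure_itv `]0%R, 1%R[) _.
    by rewrite /= lte_fin ltr01 oppr0 adde0.
  by move=> x; rewrite /= !in_itv /= => /andP[->].
- by apply/measurable_EFinP; exact: measurable_indic.
Qed.

Section final.
Variables (L : nat) (t : tree).
Local Notation N := (4 ^+ L : R).
Local Notation K := (N ^+ 2).
Local Notation W := (Node t (tinv t)).
Local Notation w := (ev W 0 0).
Hypotheses (L0 : (0 < L)%N) (pt : pos t) (mt : mean t = 1)
  (gW : allsub (good_weight K) W)
  (n0 : nat)
  (tipW : K / 2 <= mean (sub W n0 0) * mean (tinv (sub W n0 0)))
  (d0 : nat) (gt : 3 / 32 * L%:R * K <= gain d0 t (tinv t)).

Let pit : pos (tinv t). Proof. exact: pos_tinv. Qed.

Let pW : pos W. Proof. by split. Qed.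

Let K0 : 0 < K. Proof. by rewrite !exprn_gt0. Qed.

Let n0lt : (0 < 2 ^ n0)%N. Proof. by rewrite expn_gt0. Qed.

Lemma A2_bounds : ((K / 2)%:E <= A2const w <= (3 * K)%:E)%E.
Proof.
apply/andP; split.
  by apply: le_trans (A2const_ge pW n0lt); rewrite lee_fin.
by apply: A2const_le => //; apply: allsub_impl pW gW => s _ [].
Qed.

Let T0 : 0 < 43 * K. Proof. by rewrite mulr_gt0. Qed.

Let KE : 172 * K = 4 * (43 * K). Proof. by ring. Qed.

Lemma maximal_recip_bounds :
  ((Num.sqrt (K / 2))%:E <= maximal_norm (recip w) <= (Num.sqrt (172 * K))%:E)%E.
Proof.
rewrite recip_ev KE; apply/andP; split.
  by apply: le_trans (maximal_norm_ge pW n0lt); rewrite lee_fin ler_wsqrtr.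
by apply: maximal_norm_le => //; apply: allsub_impl pW gW => s _ [].
Qed.

(** The maximal bounds concern the inverse of a tree, so [w] is read as the inverse of [tinv W]. *)
Lemma maximal_bounds :
  ((Num.sqrt (K / 2))%:E <= maximal_norm w <= (Num.sqrt (172 * K))%:E)%E.
Proof.
have piW := pos_tinv pW; rewrite -[in w](tinvK W) KE; apply/andP; split.
  apply: le_trans (maximal_norm_ge piW n0lt).
  by rewrite lee_fin; apply: ler_wsqrtr; rewrite sub_tinv tinvK [leRHS]mulrC.
apply: maximal_norm_le => //.
by apply: allsub_impl piW (allsub_good_weight_tinv gW) => s _ [].
Qed.

Let sqrt_half : 0 < Num.sqrt (1 / 2 : R). Proof. by rewrite sqrtr_gt0. Qed.

(** Each test function lives on one half of [0, 1), which puts a factor 1/2 in its squared norm and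
    in the gain alike. *)
Let sqrt_gain : Num.sqrt (3 / 32 * L%:R * K) =
  Num.sqrt (3 / 32 * L%:R * K / 2) / Num.sqrt (1 / 2).
Proof.
have h : 0 <= 3 / 32 * L%:R * K by rewrite !mulr_ge0 // ltW.
have -> : 3 / 32 * L%:R * K / 2 = 3 / 32 * L%:R * K * (1 / 2) by lra.
by rewrite [in RHS]sqrtrM// mulfK// gt_eqF.
Qed.

(** On the left half [w] is [t], so [S_w] of this indicator, measured in [1 / w], tests [S] on [t]
    itself. *)
Let fl := ev (Node (Leaf 1) (Leaf 0) : tree) 0 0.

Let wfl : (fun x => w x * fl x) = ev (Node t (Leaf 0)) 0 0.
Proof. by apply/funext => x; rewrite /fl /=; case: ifP; rewrite ?mulr1 ?mulr0. Qed.

Let mfl : measurable_fun I0 fl. Proof. exact: measurable_ev. Qed.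

Let w0 x : I0 x -> 0 <= w x. Proof. by move=> _; rewrite ltW// pos_ev. Qed.

Let rw0 x : I0 x -> 0 <= recip w x.
Proof. by move=> _; rewrite recip_ev ltW// pos_ev//; exact: pos_tinv. Qed.

Let S_fl : ((Num.sqrt (3 / 32 * L%:R * K / 2))%:E <=
  L2norm (recip w) (square_fun_weighted w fl))%E.
Proof.
rewrite /square_fun_weighted wfl L2normE// recip_ev -[X in (X <= _)%E]/(sqrte _%:E).
have a0 : nneg (Node t (Leaf 0)) by split; [exact: pos_nneg|exact: lexx].
have := square_fun_L2_ge d0.+1 a0 (pos_tinv pW).
rewrite lee_sqrt; last first.
  apply: integral_ge0 => x _; rewrite mule_ge0 ?sqre_ge0// lee_fin ltW// pos_ev//.
  exact: pos_tinv.
apply: le_trans; rewrite lee_fin.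
have h1 : 0 <= gain d0 (Leaf 0) (tinv (tinv t)) by apply: gain_ge0; rewrite tinvK.
by have := gain_node d0 t (Leaf 0) (pos_tinv pW); move: (gt); lra.
Qed.

Let fl_norm : L2norm w (EFin \o fl) = (Num.sqrt (1 / 2))%:E.
Proof.
rewrite L2norm_EFin//; have -> : (\int[mu]_(x in I0) (fl x ^+ 2 * w x)%:E =
   \int[mu]_(x in I0) (ev (Node t (Leaf 0)) 0 0 x)%:E)%E.
  apply: eq_integral => x _; rewrite /fl /=.
  by case: ifP; rewrite ?expr1n ?expr0n ?mul1r ?mul0r.
rewrite integral_I0_ev; last by split; [exact: pos_nneg|exact: lexx].
by rewrite /= mt addr0.
Qed.

Lemma opnorm_S_weighted_L2 : ((Num.sqrt (3 / 32 * L%:R * K))%:E <=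
  opnorm (L2norm w) (L2norm (recip w)) (square_fun_weighted w))%E.
Proof. by rewrite sqrt_gain; exact: opnorm_ge mfl sqrt_half fl_norm S_fl. Qed.

Lemma opnorm_S_weighted_L21 : ((Num.sqrt (3 / 32 * L%:R * K))%:E <=
  opnorm (L21norm w) (L2norm (recip w)) (square_fun_weighted w))%E.
Proof.
rewrite sqrt_gain; apply: opnorm_ge mfl sqrt_half _ S_fl.
apply: L21norm_left; first exact: ltW.
rewrite integral_ev_sub//; last exact: pos_nneg.
by rewrite /= mt expr1 sqr_sqrtr.
Qed.

(** On the right half [w] is [1 / t]; placing [t] there again tests [S] on [t] against [1 / t]. *)
Lemma opnorm_S_L2 : ((Num.sqrt (3 / 32 * L%:R * K))%:E <=
  opnorm (L2norm w) (L2norm w) square_fun)%E.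
Proof.
rewrite sqrt_gain; have a0 : nneg (Node (Leaf 0) t) by split; [exact: lexx|exact: pos_nneg].
apply: (opnorm_ge (f := ev (Node (Leaf 0) t) 0 0)) => //.
- exact: measurable_ev.
- rewrite L2norm_EFin//.
  have -> : (\int[mu]_(x in I0) (ev (Node (Leaf 0) t) 0 0 x ^+ 2 * w x)%:E =
     \int[mu]_(x in I0) (ev (Node (Leaf 0) t) 0 0 x)%:E)%E.
    apply: eq_integral => x _ /=; case: ifP; rewrite ?expr0n ?mul0r// ev_tinv.
    by rewrite expr2 mulfK// gt_eqF// pos_ev.
  by rewrite integral_I0_ev//= mt add0r.
- rewrite L2normE// -[X in (X <= _)%E]/(sqrte _%:E).
  have := square_fun_L2_ge d0.+1 a0 pW.
  rewrite lee_sqrt; last first.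
    by apply: integral_ge0 => x _; rewrite mule_ge0 ?sqre_ge0// lee_fin ltW// pos_ev.
  apply: le_trans; rewrite lee_fin.
  have h1 : 0 <= gain d0 (Leaf 0) t by exact: gain_ge0.
  by have := gain_node d0 (Leaf 0) t pW; move: (gt); lra.
Qed.

End final.

End weights.

(** * The sequence of weights and its constants *)

Unset Implicit Arguments.
Local Open Scope ereal_scope.

Theorem theorem4p2 (R : realType) :
  exists (c c1 c2 : R) (w : nat -> R -> R),
    [/\ (0 < c)%R, (0 < c1)%R, (0 < c2)%R,
        (forall n, A2 (w n)) &
        A2const (w n) @[n --> \oo] --> +oo] /\
    forall n : nat,
      let M := maximal_norm (recip (w n)) in
      let M' := maximal_norm (w n) in
      [/\ c1%:E * M ^+ 2 <= A2const (w n) <= c2%:E * M ^+ 2,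
          c%:E * M * (lne M `^ 2^-1) <=
            opnorm (L2norm (w n)) (L2norm (recip (w n)))
              (square_fun_weighted (w n)),
          c%:E * M * (lne M `^ 2^-1) <=
            opnorm (L21norm (w n)) (L2norm (recip (w n)))
              (square_fun_weighted (w n)) &
          c%:E * M' * (lne M' `^ 2^-1) <=
            opnorm (L2norm (w n)) (L2norm (w n)) square_fun].
Proof.
have [t Ht] := choice (fun n => @exists_weight_tree R n.+1 (ltn0Sn n)).
pose w n := ev (Node (t n) (tinv (t n))) 0 0.
have pt n : pos (t n) by case: (Ht n).
have pW n : pos (Node (t n) (tinv (t n))) by split; [|exact: pos_tinv].
have A2b n : ((4 ^+ n.+1) ^+ 2 / 2)%:E <= A2const (w n) <= (3 * (4 ^+ n.+1) ^+ 2)%:E.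
  by have [_ _ gW [n0 tip] _] := Ht n; exact: A2_bounds gW n0 tip.
have sqrt_sandwich (K : R) (x : \bar R) :
    (Num.sqrt (K / 2))%:E <= x <= (Num.sqrt (172 * K))%:E ->
    exists2 m : R, x = m%:E & (Num.sqrt (K / 2) <= m <= Num.sqrt (172 * K))%R.
  by case: x => [m||] /andP[]//; rewrite !lee_fin => h1 h2; exists m => //; rewrite h1.
(* [1 / 129] comes from [norm_bound]. Since [K / 2 <= M^2 <= 172 K] and the A_2 constant lies
   between [K / 2] and [3 K], the comparison constants are [1 / (2 * 172)] and [2 * 3]. *)
exists (1 / 129)%R, (1 / 344)%R, 6%R, w; split.
  split; [lra..| |].
  - move=> n; split; first exact: weight_ev.
    by case/andP: (A2b n) => _ /le_lt_trans; apply; rewrite ltry.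
  - apply/cvgeyPge => A; near=> n.
    case/andP: (A2b n) => + _; apply: le_trans; rewrite lee_fin.
    apply: (@le_trans _ _ n%:R%R); first by near: n; exact: nbhs_infty_ger.
    have nN : (n%:R <= 4 ^+ n.+1 :> R)%R.
      by rewrite -natrX ler_nat ltnW// (leq_trans _ (ltn_expl _ _))// ltnS.
    have N4 : (4 <= 4 ^+ n.+1 :> R)%R by rewrite -natrX ler_nat expnS leq_pmulr// expn_gt0.
    move: (4 ^+ n.+1)%R nN N4 => z nN N4.
    have : (4 * z <= z * z)%R by rewrite ler_wpM2r//; lra.
    by rewrite expr2; lra.
move=> n M M'; have [_ mt gW [n0 tip] [d gd]] := Ht n.
set K : R := ((4 ^+ n.+1) ^+ 2)%R in gW tip gd.
have K0 : (0 < K)%R by rewrite !exprn_gt0.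
have [m Mm mb] := sqrt_sandwich _ _ (maximal_recip_bounds (pt n) gW tip).
have [m' Mm' mb'] := sqrt_sandwich _ _ (maximal_bounds (pt n) gW tip).
rewrite -/(w n) in Mm Mm'; rewrite /M /M' Mm Mm'; split.
- have /andP[A2l A2u] : (K / 2)%:E <= A2const (w n) <= (3 * K)%:E := A2b n.
  have /andP[m1 m2] := mb.
  have m0 : (0 <= m)%R by apply: le_trans m1; exact: sqrtr_ge0.
  have h1 : (K / 2 <= m ^+ 2)%R.
    have <- : (Num.sqrt (K / 2) ^+ 2 = K / 2)%R by rewrite sqr_sqrtr//; lra.
    by apply: lerXn2r; rewrite ?nnegrE ?sqrtr_ge0.
  have h2 : (m ^+ 2 <= 172 * K)%R.
    have <- : (Num.sqrt (172 * K) ^+ 2 = 172 * K)%R by rewrite sqr_sqrtr//; lra.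
    by apply: lerXn2r; rewrite ?nnegrE ?sqrtr_ge0.
  rewrite -EFin_expe -!EFinM; apply/andP; split.
    by apply: le_trans A2l; rewrite lee_fin; move: (K) h2 => z; lra.
  by apply: le_trans A2u _; rewrite lee_fin; move: (K) h1 => z; lra.
- apply: le_trans (norm_bound (ltn0Sn n) (erefl K) mb) _.
  exact: opnorm_S_weighted_L2 gd.
- apply: le_trans (norm_bound (ltn0Sn n) (erefl K) mb) _.
  exact: opnorm_S_weighted_L21 gd.
- apply: le_trans (norm_bound (ltn0Sn n) (erefl K) mb') _.
  exact: opnorm_S_L2 gd.
Unshelve. all: by end_near. Qed.
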